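(* Let $\mathbf A$ be the finite element stiffness matrix, let $\mathbf B$ be a symmetric matrix, and let $\{\mathbf u^{(k)}\}_{k\ge0}$ be generated from an initial guess $\mathbf u^{(0)}$ by $\mathbf u^{(k+1)}=\mathbf u^{(k)}+\mathbf B(\mathbf f-\mathbf A\mathbf u^{(k)})$. Let $\mathbf u$ be the solution of $\mathbf A\mathbf u=\mathbf f$, $\mathbf e^{(k)}=\mathbf u-\mathbf u^{(k)}$ and $\mathbf r_k=\mathbf A\mathbf e^{(k)}$, with $\mathbf r_0\ne0$. Assume that the error propagation matrix $\mathbf I-\mathbf B\mathbf A$ has eigenvalues $1>\rho_{\mathrm{err}}=\lambda_1\ge\lambda_2\ge\cdots\ge\lambda_n>0$. For $k\ge1$ define $$\rho_{\mathrm{err}}^{(k)}=\frac{\|\mathbf r_k\|_2}{\|\mathbf r_{k-1}\|_2},\qquad \eta_a^{(k+1)}=e^{1/k}\,\frac{\rho_{\mathrm{err}}^{(k)}}{1-\rho_{\mathrm{err}}^{(k)}}\,\|\mathbf u^{(k+1)}-\mathbf u^{(k)}\|_{\mathbf A}=e^{1/k}\,\frac{\rho_{\mathrm{err}}^{(k)}}{1-\rho_{\mathrm{err}}^{(k)}}\,\|u_{\mathcal T}^{(k+1)}-u_{\mathcal T}^{(k)}\|_A .$$ Then there exists a positive integer $N$ such that for all $k\ge N$ $$\|\mathbf e^{(k+1)}\|_{\mathbf A}=\|u_{\mathcal T}-u_{\mathcal T}^{(k+1)}\|_A\le\eta_a^{(k+1)} .$$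
   Context: $\Omega\subset\mathbb R^d$ ($d=2,3$) is a bounded polygonal/polyhedral domain with a quasi-uniform, shape-regular conforming simplicial triangulation $\mathcal T$; $\mathcal S^1=\{v\in H^1(\Omega): v|_K\in P_1(K)\ \forall K\in\mathcal T\}$. The scalar coefficient $A>0$ and the datum $f$ are piecewise constant on $\mathcal T$, $g$ is the trace of a function in $\mathcal S^1$, and $H^1_g(\Omega)=\{v\in H^1(\Omega):v=g\text{ on }\partial\Omega\}$. $(\cdot,\cdot)$ is the $L^2(\Omega)$ inner product and $\|v\|_A^2=(A\nabla v,\nabla v)$. The finite element approximation $u_{\mathcal T}\in\mathcal S^1\cap H^1_g(\Omega)$ satisfies $(A\nabla u_{\mathcal T},\nabla v)=(f,v)$ for all $v\in\mathcal S^1\cap H^1_0(\Omega)$. With $\phi_{z_i}$ the nodal basis functions of $\mathcal S^1$ at the interior vertices $z_i$, $i=1,\dots,n$, the stiffness matrix is $\mathbf A[i,j]=(A\nabla\phi_{z_j},\nabla\phi_{z_i})$ (symmetric positive definite), and $\mathbf f[i]=(f,\phi_{z_i})-(A\nabla g_h,\nabla\phi_{z_i})$, where $g_h\in\mathcal S^1$ equals $g$ at boundary vertices and $0$ at interior vertices. The solution $\mathbf u$ of $\mathbf A\mathbf u=\mathbf f$ is the vector of interior nodal values of $u_{\mathcal T}$; $u_{\mathcal T}^{(k)}\in\mathcal S^1\cap H^1_g(\Omega)$ is the function with interior nodal values $\mathbf u^{(k)}$ and boundary values $g$. Norms: $\|\mathbf v\|_2=\sqrt{\mathbf v\cdot\mathbf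 v}$ and $\|\mathbf v\|_{\mathbf A}=\sqrt{\mathbf A\mathbf v\cdot\mathbf v}$. $\rho_{\mathrm{err}}$ denotes the spectral radius of $\mathbf I-\mathbf B\mathbf A$. *)

(* Defs.v *)
From HB Require Import structures.
From mathcomp Require Import all_boot all_order all_algebra.
From mathcomp Require Import all_classical all_reals all_analysis.
From mathcomp Require Import complex.

Set Implicit Arguments.
Unset Strict Implicit.
Unset Printing Implicit Defensive.
Import Order.TTheory GRing.Theory Num.Theory.
Import numFieldNormedType.Exports.

Local Open Scope classical_set_scope.
Local Open Scope ring_scope.

(* Borel sigma-algebra of R^n, generated by the coordinate functions (as the
   library does for tuples). *)
Definition measure_row_display : measure_display -> measure_display.
Proof. exact. Qed.

Section measurable_row.
Context {d} {T : sigmaRingType d} (n : nat).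

Let coord_row : 'I_n -> 'rV[T]_n -> T := fun i x => x ord0 i.

Let row_set0 : g_sigma_preimage coord_row set0.
Proof. exact: sigma_algebra0. Qed.

Let row_setC A : g_sigma_preimage coord_row A -> g_sigma_preimage coord_row (~` A).
Proof. exact: sigma_algebraC. Qed.

Let row_bigcup (F : _^nat) : (forall i, g_sigma_preimage coord_row (F i)) ->
  g_sigma_preimage coord_row (\bigcup_i (F i)).
Proof. exact: sigma_algebra_bigcup. Qed.

HB.instance Definition _ := @isMeasurable.Build (measure_row_display d)
  'rV[T]_n (g_sigma_preimage coord_row) row_set0 row_setC row_bigcup.

End measurable_row.

Lemma measurable_coord_row d (T : sigmaRingType d) n (i : 'I_n) :
  measurable_fun [set: 'rV[T]_n] (fun x : 'rV[T]_n => x ord0 i).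
Proof.
move=> _ Y mY; rewrite setTI; apply: sub_sigma_algebra => /=.
rewrite -bigcup_seq/=; exists i => /=; first by rewrite mem_index_enum.
by exists Y => //; rewrite setTI.
Qed.

Lemma measurable_fun_row d1 d2 (T1 : measurableType d1) (T2 : measurableType d2)
    n (f : T1 -> 'rV[T2]_n) :
  (forall i, measurable_fun setT (fun x => f x ord0 i)) -> measurable_fun setT f.
Proof.
move=> mf.
suff H : g_sigma_preimage (fun i x => f x ord0 i) `<=` measurable.
  move=> _ A mA; apply: H.
  rewrite (g_sigma_preimage_comp (fun i (x : 'rV[T2]_n) => x ord0 i) f).
  by exists A.
apply: smallest_sub; first exact: sigma_algebra_measurable.
rewrite -bigcup_seq; apply: bigcup_sub => i _ A [B mB <-]; exact: mf.
Qed.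

Section lebesgue_row.
Context {R : realType}.
Local Notation RT := (measurableTypeR R).

Definition row_cons n (p : RT * 'rV[R]_n) : 'rV[R]_n.+1 :=
  row_mx (p.1)%:M p.2 : 'rV[R]_(1 + n).

Lemma row_cons0 n (p : RT * 'rV[R]_n) : row_cons p ord0 ord0 = p.1.
Proof.
by rewrite /row_cons mxE; case: splitP => // j _; rewrite (ord1 j) mxE eqxx mulr1n.
Qed.

Lemma row_consS n (p : RT * 'rV[R]_n) (i : 'I_n) :
  row_cons p ord0 (lift ord0 i) = p.2 ord0 i.
Proof.
rewrite /row_cons mxE; case: splitP => [j|j [] /val_inj -> //].
by rewrite ord1.
Qed.

Lemma measurable_row_cons n : measurable_fun setT (@row_cons n).
Proof.
apply: measurable_fun_row => i.
case: (unliftP ord0 i) => [j|] ->.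
- rewrite (_ : (fun _ => _) = (fun x : 'rV[R]_n => x ord0 j) \o snd); last first.
    by apply/funext => p; rewrite row_consS.
  by apply: measurableT_comp => //; exact: measurable_coord_row.
- rewrite (_ : (fun _ => _) = fst); last by apply/funext => p; rewrite row_cons0.
  exact: measurable_fst.
Qed.

Definition lebesgue_cons n (m : {sigma_finite_measure set 'rV[R]_n -> \bar R}) :
    set 'rV[R]_n.+1 -> \bar R :=
  pushforward (@lebesgue_measure R \x m)%E (@row_cons n).

Section lebesgue_cons_measure.
Context n (m : {sigma_finite_measure set 'rV[R]_n -> \bar R}).
Local Open Scope ereal_scope.

Let mrow_cons A : measurable A -> measurable (@row_cons n @^-1` A).
Proof. by move=> mA; rewrite -[X in measurable X]setTI; exact: measurable_row_cons. Qed.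

Let lebesgue_cons0 : lebesgue_cons m set0 = 0%E.
Proof. by rewrite /lebesgue_cons /pushforward preimage_set0 measure0. Qed.

Let lebesgue_cons_ge0 A : (0 <= lebesgue_cons m A)%E.
Proof. exact: (measure_ge0 (@lebesgue_measure R \x m)%E). Qed.

Let lebesgue_cons_sigma_additive : semi_sigma_additive (lebesgue_cons m).
Proof.
move=> F mF tF mUF; rewrite /lebesgue_cons /pushforward preimage_bigcup.
apply: measure_semi_sigma_additive.
- by move=> k; exact: mrow_cons.
- apply/trivIsetP => /= i j _ _ ij; rewrite -preimage_setI.
  by move/trivIsetP : tF => /(_ _ _ _ _ ij) ->//; rewrite preimage_set0.
- by rewrite -preimage_bigcup; exact: mrow_cons.
Qed.

HB.instance Definition _ := isMeasure.Build _ _ _ (lebesgue_cons m)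
  lebesgue_cons0 lebesgue_cons_ge0 lebesgue_cons_sigma_additive.

Let row_uncons (x : 'rV[R]_n.+1) : RT * 'rV[R]_n :=
  (x ord0 ord0, \row_i x ord0 (lift ord0 i)).

Let row_consK : cancel (@row_cons n) row_uncons.
Proof.
move=> p; rewrite /row_uncons row_cons0 [RHS]surjective_pairing; congr pair.
by apply/rowP => i; rewrite mxE row_consS.
Qed.

Let mrow_uncons : measurable_fun setT row_uncons.
Proof.
apply: measurable_fun_pair; first exact: measurable_coord_row.
apply: measurable_fun_row => i; under eq_fun do rewrite mxE.
exact: measurable_coord_row.
Qed.

Let lebesgue_cons_sigma_finite : sigma_finite setT (lebesgue_cons m).
Proof.
have [F TF Foo] : sigma_finite setT (@lebesgue_measure R \x m).
  have /sigma_finiteP[F [TF ndF Foo]] := sigma_finiteT (@lebesgue_measure R).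
  have /sigma_finiteP[G [TG ndG Goo]] := sigma_finiteT m.
  exists (fun k => F k `*` G k).
    rewrite -setXTT TF TG predeqE => -[x y]; split.
      move=> [/= [k _ Fkx] [l _ Gly]]; exists (maxn k l) => //; split.
      - by move: x Fkx; exact/subsetPset/ndF/leq_maxl.
      - by move: y Gly; exact/subsetPset/ndG/leq_maxr.
    by move=> [k _ []/= ? ?]; split; exists k.
  move=> k; have [mF ?] := Foo k; have [mG ?] := Goo k.
  split; first exact: measurableX.
  by rewrite product_measure1E// lte_mul_pinfty// ge0_fin_numE.
exists (fun k => row_uncons @^-1` F k).
  by rewrite -preimage_bigcup -TF preimage_setT.
move=> k; have [mF Fk] := Foo k; split.
  by rewrite -[X in measurable X]setTI; exact: mrow_uncons.
rewrite /lebesgue_cons /pushforward -comp_preimage.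
by rewrite (_ : row_uncons \o _ = id)//; apply/funext => p /=; rewrite row_consK.
Qed.

HB.instance Definition _ := Measure_isSigmaFinite.Build _ _ _ (lebesgue_cons m)
  lebesgue_cons_sigma_finite.

End lebesgue_cons_measure.

(* n-dimensional Lebesgue measure, as an iterated product measure. *)
Fixpoint lebesgue n : {sigma_finite_measure set 'rV[R]_n -> \bar R} :=
  if n is n'.+1 then lebesgue_cons (lebesgue n') else \d_(0 : 'rV[R]_0).

Lemma lebesgue_box n (a b : 'rV[R]_n) : (forall i, a ord0 i <= b ord0 i) ->
  lebesgue n [set x | forall i, x ord0 i \in `[a ord0 i, b ord0 i]%R] =
  (\prod_(i < n) (b ord0 i - a ord0 i))%:E.
Proof.
elim: n a b => [|n IH] a b ab.
  rewrite /= big_ord0 diracE mem_set//= => i; by case: i.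
pose a' := \row_i a ord0 (lift ord0 i); pose b' := \row_i b ord0 (lift ord0 i).
rewrite /= /lebesgue_cons /pushforward.
rewrite [X in (_ \x _)%E X](_ : _ = `[a ord0 ord0, b ord0 ord0]%classic `*`
  [set x : 'rV[R]_n | forall i, x ord0 i \in `[a' ord0 i, b' ord0 i]%R]); last first.
  apply/seteqP; split => [p /= H|p /= [H0 H] i].
    split; first by have := H ord0; rewrite row_cons0.
    by move=> i; have := H (lift ord0 i); rewrite row_consS !mxE.
  case: (unliftP ord0 i) => [j|] ->; last by rewrite row_cons0.
  by rewrite row_consS; have := H j; rewrite !mxE.
rewrite product_measure1E//=; last first.
  rewrite (_ : mkset _ = \bigcap_(i in [set: 'I_n])
    ((fun x : 'rV[R]_n => x ord0 i) @^-1` `[a' ord0 i, b' ord0 i])); last first.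
    apply/seteqP; split => [x /= H i _ |x H i] /=; first exact: H.
    exact: (H i I).
  apply: fin_bigcap_measurable => // i _.
  by rewrite -[X in measurable X]setTI; apply: measurable_coord_row.
rewrite lebesgue_measure_itv/= IH; last by move=> i; rewrite !mxE.
rewrite big_ord_recl EFinM; congr (_ * _)%E.
  rewrite lte_fin; case: ltP => // ba.
  by rewrite (@le_anti _ _ (b ord0 ord0) (a ord0 ord0)) ?subrr// ba ab.
by congr EFin; apply: eq_bigr => i _; rewrite !mxE.
Qed.

End lebesgue_row.

Section sobolev.
Context {R : realType} (d : nat).

Definition dotr (x y : 'rV[R]_d) : R := \sum_(j < d) x ord0 j * y ord0 j.

Definition enorm (x : 'rV[R]_d) : R := Num.sqrt (dotr x x).

Definition partial (j : 'I_d) (v : 'rV[R]_d -> R) : 'rV[R]_d -> R :=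
  fun x => 'D_(delta_mx ord0 j) v x.

(* Differentiability of every iterated partial derivative, i.e. C^oo. *)
Definition smooth (v : 'rV[R]_d -> R) : Prop :=
  forall (s : seq 'I_d) (x : 'rV[R]_d), differentiable (foldr partial v s) x.

Definition test_function (Omega : set 'rV[R]_d) (v : 'rV[R]_d -> R) : Prop :=
  [/\ smooth v, compact (closure [set x | v x != 0]) &
      closure [set x | v x != 0] `<=` Omega].

Definition L2 (Omega : set 'rV[R]_d) (v : 'rV[R]_d -> R) : Prop :=
  measurable_fun Omega v /\
  (lebesgue d).-integrable Omega (fun x => (v x ^+ 2)%:E).

Definition L2dot (Omega : set 'rV[R]_d) (v w : 'rV[R]_d -> R) : R :=
  \int[lebesgue d]_(x in Omega) (v x * w x).

Definition is_weak_gradient (Omega : set 'rV[R]_d) (v : 'rV[R]_d -> R)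
    (G : 'rV[R]_d -> 'rV[R]_d) : Prop :=
  forall j : 'I_d, L2 Omega (fun x => G x ord0 j) /\
    forall psi, test_function Omega psi ->
      L2dot Omega v (partial j psi) = - L2dot Omega (fun x => G x ord0 j) psi.

Definition H1 (Omega : set 'rV[R]_d) (v : 'rV[R]_d -> R) : Prop :=
  L2 Omega v /\ exists G, is_weak_gradient Omega v G.

(* A representative of the weak gradient, which is unique up to a null set. *)
Definition grad (Omega : set 'rV[R]_d) (v : 'rV[R]_d -> R) :
    'rV[R]_d -> 'rV[R]_d :=
  get [set G | is_weak_gradient Omega v G].

Definition energy (Omega : set 'rV[R]_d) (A v w : 'rV[R]_d -> R) : R :=
  \int[lebesgue d]_(x in Omega)
    dotr (A x *: grad Omega v x) (grad Omega w x).

Definition energy_norm (Omega : set 'rV[R]_d) (A v : 'rV[R]_d -> R) : R :=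
  Num.sqrt (energy Omega A v v).

Definition bdry (Omega : set 'rV[R]_d) : set 'rV[R]_d :=
  closure Omega `\` interior Omega.

End sobolev.

Section finite_elements.
Context {R : realType} (d : nat).

(* A simplex is given by the set of (indices of) its vertices. *)
Record mesh := Mesh {
  nvtx : nat;
  vtx : 'I_nvtx -> 'rV[R]_d;
  simplices : {set {set 'I_nvtx}} }.

Definition cell (T : mesh) (K : {set 'I_(nvtx T)}) : set 'rV[R]_d :=
  [set x | exists w : 'I_(nvtx T) -> R,
    [/\ forall a, 0 <= w a, forall a, a \notin K -> w a = 0,
        \sum_a w a = 1 & x = \sum_a w a *: vtx a]].

Definition affinely_independent (T : mesh) (K : {set 'I_(nvtx T)}) : Prop :=
  forall w : 'I_(nvtx T) -> R, (forall a, a \notin K -> w a = 0) ->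
    \sum_a w a = 0 -> \sum_a w a *: vtx a = 0 -> forall a, w a = 0.

(* Together with the covering clause of [triangulation], the last clause says
   that Omega is the interior of a finite union of closed simplices. *)
Definition polyhedral_domain (Omega : set 'rV[R]_d) : Prop :=
  [/\ Omega !=set0, open Omega, connected Omega, bounded_set Omega &
      interior (closure Omega) = Omega].

Definition triangulation (Omega : set 'rV[R]_d) (T : mesh) : Prop :=
  [/\ injective (@vtx T),
      forall a, exists2 K, K \in simplices T & a \in K,
      forall K, K \in simplices T -> #|K| = d.+1 /\ affinely_independent K,
      forall K K', K \in simplices T -> K' \in simplices T ->
        cell K `&` cell K' = cell (K :&: K')%SET &
      closure Omega = \bigcup_(K in [set` simplices T]) cell K].

Definition diam (D : set 'rV[R]_d) : R :=
  sup [set enorm (x - y) | x in D & y in D].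

Definition inradius (D : set 'rV[R]_d) : R :=
  sup [set r | 0 <= r /\ exists x, forall y, enorm (y - x) <= r -> D y].

Definition shape_regular (sigma : R) (T : mesh) : Prop :=
  forall K, K \in simplices T -> diam (cell K) <= sigma * inradius (cell K).

Definition quasi_uniform (tau : R) (T : mesh) : Prop :=
  forall K K', K \in simplices T -> K' \in simplices T ->
    diam (cell K) <= tau * diam (cell K').

(* Interface values are immaterial (a null set); they only have to keep the
   function bounded and measurable. *)
Definition piecewise_constant (Omega : set 'rV[R]_d) (T : mesh)
    (f : 'rV[R]_d -> R) : Prop :=
  [/\ measurable_fun Omega f,
      exists M, forall x, Omega x -> `|f x| <= M &
      forall K, K \in simplices T ->
        exists c, forall x, interior (cell K) x -> f x = c].

Definition P1_on (D : set 'rV[R]_d) (v : 'rV[R]_d -> R) : Prop :=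
  exists (a : 'rV[R]_d) (b : R), forall x, D x -> v x = dotr a x + b.

(* The simplices [cell K] are closed, so [v] is the continuous representative,
   defined on the closure of Omega. *)
Definition S1 (Omega : set 'rV[R]_d) (T : mesh) (v : 'rV[R]_d -> R) : Prop :=
  H1 Omega v /\ forall K, K \in simplices T -> P1_on (cell K) v.

Definition S1_bc (Omega : set 'rV[R]_d) (T : mesh) (g v : 'rV[R]_d -> R) :
    Prop :=
  S1 Omega T v /\ forall x, bdry Omega x -> v x = g x.

Definition trace_of_S1 (Omega : set 'rV[R]_d) (T : mesh) (g : 'rV[R]_d -> R) :
    Prop :=
  exists2 v, S1 Omega T v & forall x, bdry Omega x -> g x = v x.

Definition fe_solution (Omega : set 'rV[R]_d) (T : mesh)
    (A f g u : 'rV[R]_d -> R) : Prop :=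
  S1_bc Omega T g u /\
  forall v, S1_bc Omega T (fun=> 0) v -> energy Omega A u v = L2dot Omega f v.

Definition interior_vertices (Omega : set 'rV[R]_d) (T : mesh) (n : nat)
    (z : 'I_n -> 'I_(nvtx T)) : Prop :=
  injective z /\ forall a, Omega (vtx a) <-> exists i, z i = a.

Definition nodal_basis (Omega : set 'rV[R]_d) (T : mesh) (n : nat)
    (z : 'I_n -> 'I_(nvtx T)) (phi : 'I_n -> 'rV[R]_d -> R) : Prop :=
  forall i, S1 Omega T (phi i) /\ forall a, phi i (vtx a) = (a == z i)%:R.

Definition boundary_lift (Omega : set 'rV[R]_d) (T : mesh)
    (g gh : 'rV[R]_d -> R) : Prop :=
  [/\ S1 Omega T gh,
      forall a : 'I_(nvtx T), bdry Omega (vtx a) -> gh (vtx a) = g (vtx a) &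
      forall a : 'I_(nvtx T), Omega (vtx a) -> gh (vtx a) = 0].

Definition fe_function (Omega : set 'rV[R]_d) (T : mesh) (n : nat)
    (z : 'I_n -> 'I_(nvtx T)) (g : 'rV[R]_d -> R) (c : 'cV[R]_n)
    (v : 'rV[R]_d -> R) : Prop :=
  S1_bc Omega T g v /\ forall i, v (vtx (z i)) = c i ord0.

Definition stiffness (Omega : set 'rV[R]_d) (A : 'rV[R]_d -> R) (n : nat)
    (phi : 'I_n -> 'rV[R]_d -> R) : 'M[R]_n :=
  \matrix_(i, j) energy Omega A (phi j) (phi i).

Definition load (Omega : set 'rV[R]_d) (A f gh : 'rV[R]_d -> R) (n : nat)
    (phi : 'I_n -> 'rV[R]_d -> R) : 'cV[R]_n :=
  \col_i (L2dot Omega f (phi i) - energy Omega A gh (phi i)).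

End finite_elements.
Arguments mesh R d : clear implicits.

Section linear_algebra.
Context {R : realType} (n : nat).

Definition dotc (v w : 'cV[R]_n) : R := \sum_(i < n) v i ord0 * w i ord0.

Definition norm2 (v : 'cV[R]_n) : R := Num.sqrt (dotc v v).

Definition normA (A : 'M[R]_n) (v : 'cV[R]_n) : R := Num.sqrt (dotc (A *m v) v).

Definition spectral_radius (M : 'M[R]_n) : R :=
  sup [set ComplexField.Normc.normc mu | mu in
    [set mu : R[i] | eigenvalue (map_mx (real_complex R) M) mu]].

(* Eigenvalues listed with algebraic multiplicity. *)
Definition eigenvalues_of (M : 'M[R]_n) (s : seq R) : Prop :=
  char_poly M = \prod_(l <- s) ('X - l%:P).

Definition rho_err (r : nat -> 'cV[R]_n) (k : nat) : R :=
  norm2 (r k) / norm2 (r k.-1).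

(* eta_a^(k+1), [delta] being the energy norm of the (k+1)-st increment. *)
Definition eta_a (r : nat -> 'cV[R]_n) (k : nat) (delta : R) : R :=
  expR (k%:R^-1) * (rho_err r k / (1 - rho_err r k)) * delta.

End linear_algebra.

(* Main.v *)
(* Since [1] is not an eigenvalue of [M = I - BA], the stiffness matrix [A] is
   invertible, hence, being symmetric positive semidefinite, definite; no
   Poincare inequality is needed. As [M] is self-adjoint for the energy inner
   product, [e_0] is a sum of [A]-orthogonal eigenvectors. If [l] is the largest
   eigenvalue involved, comparing components gives
   [|e_(k+1)|_A <= l / (1 - l) * |e_k - e_(k+1)|_A] for every [k], while the residual
   ratios [rho_k] satisfy [k (rho_k - l) --> 0], so that
   [l / (1 - l) <= (1 + 1/k) * rho_k / (1 - rho_k)] for large [k].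

   The energy norms of functions agree with the [A]-norms of their coefficient
   vectors because the energy, defined from an arbitrary choice of weak gradients, is
   bilinear: by the fundamental lemma of the calculus of variations weak
   gradients are unique almost everywhere. *)
Require Import Defs.
From mathcomp Require Import all_boot all_order all_algebra.
From mathcomp Require Import all_classical all_reals all_analysis.
From mathcomp Require Import measurable_realfun.
From mathcomp Require Import ring lra.
Import Order.TTheory GRing.Theory Num.Theory.
Import numFieldNormedType.Exports.
Local Open Scope classical_set_scope.
Local Open Scope ring_scope.

Set Implicit Arguments.
Unset Strict Implicit.
Unset Printing Implicit Defensive.

(** * Borel sets of [R^n] *)

(** The factor [expR (1/k)] suffices because the residual ratios settle geometrically. Eigenvectors
    are orthogonal for the energy product but not for the Euclidean one, so the squared residual
    norm is a double sum with cross terms. Divided by [l^(2k)] it becomes a sum of constants times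
    [tau^k], where [0 < tau <= 1] by positivity of the eigenvalues and [tau = 1] only for the pair
    [(l, l)]. Its increments thus decay geometrically, which beats [1/k]. A second difficulty is
    that [nodal_basis] fixes values at vertices only, while the discrete equations are tested with
    functions vanishing on the whole boundary. That hat functions do vanish there is a geometric
    fact about the covering by simplices, and it relies on [interior (closure Omega) = Omega]. *)

Lemma measurable_row_ball (R : realType) (n : nat) (c : 'rV[R]_n) (r : R) :
  measurable (ball c r).
Proof.
have [r0|r0] := ltP 0 r; last by rewrite (_ : ball c r = set0)//; apply/seteqP; split => // x []; rewrite ltNge r0.
rewrite (_ : ball c r = \bigcap_(i in [set: 'I_n])
    ((fun x : 'rV[R]_n => x ord0 i) @^-1` (ball (c ord0 i) r))); last first.
  apply/seteqP; split => [x [_ xr] i _|x xr]; first exact: xr.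
  by split => // i j; rewrite (ord1 i); exact: xr.
apply: fin_bigcap_measurable => // i _.
rewrite -[X in measurable X]setTI; apply: measurable_coord_row => //.
by apply: open_measurable; exact: ball_open.
Qed.

(** Rational centres and radii [1/(m+1)] make the cover countable. The second clause keeps even the
    closed cubes inside [U], so that bumps supported on them are test functions. *)
Lemma open_row_cover (R : realType) (n : nat) (U : set 'rV[R]_n) : open U ->
  exists (c : nat -> 'rV[R]_n) (r : nat -> R),
    U = \bigcup_k ball (c k) (r k) /\
    forall k (x : 'rV[R]_n), (forall i, `|x ord0 i - c k ord0 i| <= r k) -> 0 < r k -> U x.
Proof.
move=> oU.
pose good (p : 'rV[rat]_n * nat) := forall x : 'rV[R]_n,
  (forall i, `|x ord0 i - ratr (p.1 ord0 i)| <= p.2.+1%:R^-1) -> U x.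
pose cc k : 'rV[R]_n := if (unpickle k : option ('rV[rat]_n * nat)) is Some p
  then map_mx ratr p.1 else 0.
(* Codes of no good pair get radius [0]: [ball] is empty unless its radius is positive. *)
pose rr k : R := if (unpickle k : option ('rV[rat]_n * nat)) is Some p
  then (if `[< good p >] then p.2.+1%:R^-1 else 0) else 0.
exists cc, rr; split; last first.
  move=> k x; rewrite /cc /rr; case: (unpickle k) => [p|]; last by rewrite ltxx.
  case: ifPn => [/asboolP gp H _|_ _]; last by rewrite ltxx.
  by apply: gp => i; have := H i; rewrite mxE.
apply/seteqP; split => [x Ux|x [k _]]; last first.
  rewrite /cc /rr; case: (unpickle k) => [p|]; last by case; rewrite ltxx.
  case: ifPn => [/asboolP gp|_]; last by case; rewrite ltxx.
  move=> [_ H]; apply: gp => i; have := H ord0 i; rewrite mxE.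
  by rewrite distrC => /ltW.
have /nbhs_ballP[e /= e0 eU] := open_nbhs_nbhs (conj oU Ux).
have e20 : 0 < e / 2 by rewrite divr_gt0.
have [m me] : exists m : nat, m.+1%:R^-1 < e / 2.
  have [m _ H] := near_infty_natSinv_lt (PosNum e20).
  by exists m; have := H m (leqnn m).
have m0 : 0 < m.+1%:R^-1 :> R by rewrite invr_gt0.
have Q i : {q : rat | `|x ord0 i - ratr q| < m.+1%:R^-1}.
  apply/cid; have [|q] := @rat_in_itvoo R (x ord0 i - m.+1%:R^-1) (x ord0 i + m.+1%:R^-1).
    by apply: (@lt_trans _ _ (x ord0 i)); rewrite ?ltrDl// ltrBlDr ltrDl.
  rewrite in_itv/= => /andP[]; set t := m.+1%:R^-1; move=> q1 q2; exists q; move: q1 q2.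
  by move: (x ord0 i) (ratr q : R) => y p q1 q2; rewrite ltr_norml; apply/andP; split; lra.
pose p : 'rV[rat]_n * nat := (\row_i sval (Q i), m).
have gp : good p.
  move=> y /= yp; apply: eU; split => // i j; rewrite (ord1 i).
  have := yp j; rewrite mxE; have := svalP (Q j); set q := ratr _ => h1 h2.
  move: h1 h2 me; set t : R := m.+1%:R^-1; move=> h1 h2 me.
  rewrite /ball/=; rewrite (_ : _ - _ = (x ord0 j - q) - (y ord0 j - q)); last by ring.
  rewrite (le_lt_trans (ler_normB _ _))//; lra.
exists (pickle p) => //; rewrite /cc /rr pickleK; case: ifPn => [_|/asboolP//].
split => // i j; rewrite (ord1 i) mxE /ball/= distrC mxE.
by have := svalP (Q j).
Qed.

Lemma open_row_measurable (R : realType) (n : nat) (U : set 'rV[R]_n) :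
  open U -> measurable U.
Proof.
move=> /open_row_cover[c [r [-> _]]]; apply: bigcupT_measurable => k.
exact: measurable_row_ball.
Qed.

Lemma continuous_row_measurable (R : realType) (n : nat) (D : set 'rV[R]_n)
    (v : 'rV[R]_n -> R) : measurable D -> continuous v -> measurable_fun D v.
Proof.
move=> mD /continuousP cv; apply: (measurability _ (RGenOpens.measurableE R)) => //.
move=> _ [_ [a [b ->] <-]].
apply: measurableI => //; apply: open_row_measurable; apply: cv.
exact: interval_open.
Qed.

Lemma mx_entry_le_norm (R : realType) (m n : nat) (x : 'M[R]_(m, n)) i j :
  `|x i j| <= `|x|.
Proof.
rewrite (_ : `|x| = mx_norm x)// mx_normrE; apply/bigmax_geP; right => /=.
by exists (i, j).
Qed.

Lemma row_box_compact (R : realType) (n : nat) (a b : 'rV[R]_n) :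
  compact [set x : 'rV[R]_n | forall i, x ord0 i \in `[a ord0 i, b ord0 i]].
Proof.
apply: (@rV_compact _ _ (fun i => `[a ord0 i, b ord0 i]%classic)) => i.
exact: segment_compact.
Qed.

Lemma compact_row_measurable (R : realType) (n : nat) (K : set 'rV[R]_n) :
  compact K -> measurable K.
Proof.
move=> /(compact_closed (@norm_hausdorff _ _)) /closed_openC.
by move=> /open_row_measurable/measurableC; rewrite setCK.
Qed.

Lemma bounded_subset_box (R : realType) (n : nat) (D : set 'rV[R]_n) :
  bounded_set D -> exists a b : 'rV[R]_n, (forall i, a ord0 i <= b ord0 i) /\
    D `<=` [set x | forall i, x ord0 i \in `[a ord0 i, b ord0 i]].
Proof.
move=> [M [Mreal DM]]; pose N : R := `|M| + 1.
exists (- const_mx N), (const_mx N); split.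
  by move=> i; rewrite !mxE /N; have := normr_ge0 M; lra.
move=> x /(DM N); rewrite /N => H i; rewrite !mxE in_itv/= -ler_norml.
have /H : M < `|M| + 1 by rewrite (le_lt_trans (ler_norm M))// ltrDl.
by apply: le_trans; exact: mx_entry_le_norm.
Qed.

Lemma lebesgue_bounded (R : realType) (n : nat) (D : set 'rV[R]_n) :
  measurable D -> bounded_set D -> (lebesgue n D < +oo)%E.
Proof.
move=> mD /bounded_subset_box[a [b [ab Dab]]].
apply: (@le_lt_trans _ _ (lebesgue n _)).
  apply: le_measure Dab; rewrite ?inE//.
  by apply: compact_row_measurable; apply: row_box_compact.
by rewrite lebesgue_box ?ltry.
Qed.

(** * Smooth bump functions *)

Section flat_function.
Context {R : realType}.
Implicit Types (m : nat) (c t : R).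

(** The classical flat function [exp (- c / t)] is the case [m = 0]; the powers of [1/t] are what
    differentiation produces, so the family over all [m] is closed under it up to linear
    combinations. *)
Definition flat m c t : R := if 0 < t then t^-1 ^+ m * expR (- c * t^-1) else 0.

Lemma flat_pos m c t : 0 < t -> flat m c t = t^-1 ^+ m * expR (- c * t^-1).
Proof. by rewrite /flat => ->. Qed.

Lemma flat_npos m c t : t <= 0 -> flat m c t = 0.
Proof. by rewrite /flat leNgt => /negbTE ->. Qed.

(** With [s = 1/t], the Taylor term [(c s)^(m+2) / (m+2)!] bounds [exp (c s)] from below. Two orders
    more than [m] leave the factor [t^2], which makes the derivative at [0] vanish. *)
Lemma flat_le_sqr m c t : 0 < c ->
  `|flat m c t| <= m.+2`!%:R / c ^+ m.+2 * t ^+ 2.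
Proof.
move=> c0; have K0 : 0 <= m.+2`!%:R / c ^+ m.+2.
  by rewrite divr_ge0// exprn_ge0// ltW.
have [t0|t0] := ltP 0 t; last first.
  by rewrite flat_npos// normr0 mulr_ge0// sqr_ge0.
rewrite flat_pos// ger0_norm; last first.
  by rewrite mulr_ge0 ?expR_ge0// exprn_ge0// invr_ge0 ltW.
set s := t^-1; have s0 : 0 < s by rewrite invr_gt0.
have -> : t = s^-1 by rewrite invrK.
have := @expR_ge1Dxn R (c * s) m.+1 (mulr_ge0 (ltW c0) (ltW s0)).
rewrite mulNr expRN => h.
have h' : (c * s) ^+ m.+2 / m.+2`!%:R <= expR (c * s).
  by apply: le_trans h; rewrite lerDr.
have F0 : 0 < m.+2`!%:R :> R by rewrite ltr0n fact_gt0.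
have cs0 : 0 < (c * s) ^+ m.+2 / m.+2`!%:R.
  by rewrite divr_gt0// exprn_gt0// mulr_gt0.
apply: (@le_trans _ _ (s ^+ m * ((c * s) ^+ m.+2 / m.+2`!%:R)^-1)).
  by rewrite ler_pM2l ?exprn_gt0// lef_pV2 ?posrE ?expR_gt0.
rewrite le_eqVlt; apply/orP; left; apply/eqP.
have q0 := exprn_gt0 m.+2 c0; have p0 := exprn_gt0 m s0.
rewrite exprMn; move: F0 q0; set F := _%:R; set q := c ^+ _ => F0 q0.
rewrite -[m.+2]/(2 + m)%N (exprD s 2 m).
move: p0; move: (s ^+ m) => p p0.
by field; rewrite !gt_eqF.
Qed.

Lemma is_derive_flat m c t : 0 < c ->
  is_derive t 1 (flat m c) (- m%:R * flat m.+1 c t + c * flat m.+2 c t).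
Proof.
move=> c0; have [t0|t0|->] := ltgtP t 0.
- rewrite !flat_npos ?ltW// !mulr0 addr0.
  apply: (@near_eq_is_derive _ _ _ (cst 0)).
  by near=> x; rewrite flat_npos//; apply: ltW; near: x; exact: lt_nbhsl.
- rewrite !flat_pos//.
  apply: (@near_eq_is_derive _ _ _ (fun t => t^-1 ^+ m * expR (- c * t^-1))).
    by near=> x; rewrite flat_pos//; near: x; exact: lt_nbhsr.
  have tn0 : t != 0 by rewrite gt_eqF.
  have dV : is_derive t 1 (fun y : R => y^-1) (- t ^- 2 *: (1 : R)).
    exact: (@is_deriveV _ id).
  have dE : is_derive t 1 (fun y : R => expR (- c * y^-1)) (expR (- c * t^-1) * (- c * (- t ^- 2))).
    have : is_derive t 1 (expR \o (fun y : R => - c * y^-1)) (expR (- c * t^-1) * (- c * (- t ^- 2))).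
      apply: is_derive1_comp.
      have := @is_deriveZ _ _ _ _ (-c) _ _ _ dV.
      by rewrite /GRing.scale/= mulr1.
    by [].
  have -> : (fun y => y^-1 ^+ m * expR (- c / y)) =
      (fun y : R => y^-1) ^+ m * (fun y : R => expR (- c * y^-1)) :> (R -> R).
    by apply/funext => y; rewrite mulrfctE exprfctE.
  apply: is_derive_eq (is_deriveM (is_deriveX m dV) dE) _.
  rewrite /GRing.scale/= !fctE mulr1.
  rewrite -!exprVn; set e := expR _; set s := t^-1.
  by case: m => [|m] /=; rewrite ?expr0 ?exprS; ring.
- rewrite !flat_npos// !mulr0 addr0.
  set K := m.+2`!%:R / c ^+ m.+2.
  have K0 : 0 <= K by rewrite divr_ge0// exprn_ge0// ltW.
  (* By [flat_le_sqr] the difference quotient at [0] is at most [K |h|]; the [+ 1] below avoids a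
     positivity proof for [K]. *)
  have H : (fun h : R => h^-1 *: (flat m c (h *: (1:R) + 0) - flat m c 0)) @ 0^' --> (0 : R).
    apply/cvgr0Pnorm_le => e e0.
    have eK0 : 0 < e / (K + 1) by rewrite divr_gt0// ltr_wpDl.
    near=> h; have h0 : h != 0 by near: h; exact: nbhs_dnbhs_neq.
    have he : `|h| <= e / (K + 1) by near: h; exact: dnbhs0_le.
    rewrite [flat m c 0]flat_npos// subr0 addr0 [_%:A]mulr1 normrZ normfV.
    rewrite ler_pdivrMl ?normr_gt0//.
    rewrite (le_trans (flat_le_sqr m h c0))// -/K -real_normK ?num_real//.
    rewrite expr2 mulrA mulrC ler_wpM2l//.
    move: he; rewrite ler_pdivlMr ?ltr_wpDl// mulrDr mulr1 => he.
    by rewrite mulrC (le_trans _ he)// lerDl.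
  apply: DeriveDef; first by apply/cvg_ex; exists 0.
  exact: cvg_lim H.
Unshelve. all: by end_near. Qed.

Lemma flat_ge0 m c t : 0 <= flat m c t.
Proof.
by rewrite /flat; case: ifP => // t0; rewrite mulr_ge0 ?expR_ge0// exprn_ge0// invr_ge0 ltW.
Qed.

Lemma flat0_le1 c t : 0 < c -> flat 0%N c t <= 1.
Proof.
move=> c0; rewrite /flat; case: ifP => // t0.
by rewrite expr0 mul1r expR_le1 mulNr oppr_le0 mulr_ge0// ?invr_ge0 ltW.
Qed.

Lemma flat_neq0 m c t : (flat m c t != 0) = (0 < t).
Proof.
rewrite /flat; case: ifP => [t0|]; last by rewrite eqxx.
by rewrite mulf_neq0// ?expR_eq0// expf_neq0// invr_neq0 ?gt_eqF.
Qed.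

Lemma flat0_cvg t : flat 0%N (k.+1%:R^-1) t @[k --> \oo] --> ((0 < t)%R%:R : R).
Proof.
rewrite /flat; have [t0|t0] /= := boolP (0 < t); last exact: cvg_cst.
rewrite (_ : (fun k : nat => t^-1 ^+ 0 * expR (- k.+1%:R^-1 * t^-1)) =
    (fun k : nat => expR (- k.+1%:R^-1 * t^-1))); last first.
  by apply/funext => k; rewrite expr0 mul1r.
suff : expR (- k.+1%:R^-1 * t^-1) @[k --> \oo] --> expR (- 0 * t^-1).
  by rewrite oppr0 mul0r expR0.
apply: (@continuous_cvg _ _ _ _ _ _ expR); first exact: continuous_expR.
apply: cvgMr_tmp; apply: cvgN; exact: cvg_harmonic.
Qed.

End flat_function.

Section smooth_functions.
Context {R : realType} (d : nat).
Implicit Types (x : 'rV[R]_d) (v w : 'rV[R]_d -> R).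

(* A family of functions containing the bumps below and stable under [partial]. *)
Inductive flat_poly : ('rV[R]_d -> R) -> Prop :=
| flat_poly_cst k : flat_poly (cst k)
| flat_poly_atom m c s a i : 0 < c ->
    flat_poly (fun x => flat m c (s * (x ord0 i - a)))
| flat_poly_add v w : flat_poly v -> flat_poly w -> flat_poly (v + w)
| flat_poly_mul v w : flat_poly v -> flat_poly w -> flat_poly (v * w).

Lemma is_derive_flat_coord m c s a i x (u : 'rV[R]_d) : 0 < c ->
  differentiable (fun x => flat m c (s * (x ord0 i - a))) x /\
  'D_u (fun x => flat m c (s * (x ord0 i - a))) x =
   (s * u ord0 i) * (- m%:R * flat m.+1 c (s * (x ord0 i - a)) + c * flat m.+2 c (s * (x ord0 i - a))).
Proof.
move=> c0.
pose h (x : 'rV[R]_d) : R := s * (x ord0 i - a).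
have dh : differentiable h x.
  rewrite (_ : h = s *: ((fun y : 'rV[R]_d => y ord0 i) - cst a)); last first.
    by apply/funext => y; rewrite /h !fctE.
  apply: differentiableZ; apply: differentiableB => //.
  exact: differentiable_coord.
have D := is_derive_flat m (h x) c0.
have df : differentiable (flat m c) (h x) by apply/derivable1_diffP; case: D.
have -> : (fun x => flat m c (s * (x ord0 i - a))) = flat m c \o h by [].
split; first exact: differentiable_comp.
rewrite deriveE; last exact: differentiable_comp.
rewrite diff_comp//= diff1E// derive1E derive_val /GRing.scale/=; congr (_ * _).
rewrite -deriveE// /derive; apply: cvg_lim => //.
apply: cvg_near_cst.
near=> k; have k0 : k != 0 by near: k; exact: nbhs_dnbhs_neq.
by rewrite /h /= !mxE /GRing.scale/=; field.
Unshelve. all: by end_near. Qed.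

Lemma flat_poly_partial v : flat_poly v ->
  (forall x, differentiable v x) /\ forall j, flat_poly (partial j v).
Proof.
elim=> [k|m c s a i c0|{}v w pv [dv Dv] pw [dw Dw]|{}v w pv [dv Dv] pw [dw Dw]].
- split=> [x|j]; first exact: differentiable_cst.
  rewrite (_ : partial j _ = cst 0); first exact: flat_poly_cst.
  by apply/funext => x; rewrite /partial derive_val.
- split=> [x|j]; first by have [] := is_derive_flat_coord m s a i x 0 c0.
  rewrite (_ : partial j _ = cst (s * (delta_mx ord0 j : 'rV[R]_d) ord0 i) *
    (cst (- m%:R) * (fun x => flat m.+1 c (s * (x ord0 i - a))) +
     cst c * (fun x => flat m.+2 c (s * (x ord0 i - a))))); last first.
    apply/funext => x; rewrite /partial.
    have [_ ->] := is_derive_flat_coord m s a i x (delta_mx ord0 j) c0.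
    by rewrite !fctE.
  apply: flat_poly_mul; first exact: flat_poly_cst.
  apply: flat_poly_add; apply: flat_poly_mul; do 1? exact: flat_poly_cst;
    exact: flat_poly_atom.
- split=> [x|j]; first exact: differentiableD.
  rewrite (_ : partial j _ = partial j v + partial j w); first exact: flat_poly_add.
  by apply/funext => x; rewrite /partial deriveD//; exact: diff_derivable.
- split=> [x|j]; first exact: differentiableM.
  rewrite (_ : partial j _ = v * partial j w + w * partial j v).
    by apply: flat_poly_add; apply: flat_poly_mul.
  by apply/funext => x; rewrite /partial deriveM//; exact: diff_derivable.
Qed.

Lemma flat_poly_smooth v : flat_poly v -> smooth v.
Proof.
move=> pv s; suff H : flat_poly (foldr (@partial R d) v s).
  by have [] := flat_poly_partial H.
by elim: s => //= j s /flat_poly_partial[].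
Qed.

Lemma flat_poly_prod (I : Type) (s : seq I) (F : I -> 'rV[R]_d -> R) :
  (forall i, flat_poly (F i)) -> flat_poly (fun x => \prod_(i <- s) F i x).
Proof.
move=> pF; elim: s => [|i s IH].
  rewrite (_ : (fun _ => _) = cst 1); first exact: flat_poly_cst.
  by apply/funext => x; rewrite big_nil.
rewrite (_ : (fun _ => _) = F i * (fun x => \prod_(i <- s) F i x)).
  exact: flat_poly_mul.
by apply/funext => x; rewrite big_cons.
Qed.

(* Letting [c] tend to [0] turns [exp (- c / t)] into the indicator of [t > 0]. *)
Definition box_bump (a b : 'rV[R]_d) (c : R) x : R :=
  \prod_(i < d) (flat 0%N c (x ord0 i - a ord0 i) * flat 0%N c (b ord0 i - x ord0 i)).

Definition open_box (a b : 'rV[R]_d) : set 'rV[R]_d :=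
  [set x | forall i, x ord0 i \in `]a ord0 i, b ord0 i[].

Definition closed_box (a b : 'rV[R]_d) : set 'rV[R]_d :=
  [set x | forall i, x ord0 i \in `[a ord0 i, b ord0 i]].

Lemma box_bump_ge0 a b c x : 0 <= box_bump a b c x.
Proof. by apply: prodr_ge0 => i _; rewrite mulr_ge0// flat_ge0. Qed.

Lemma box_bump_le1 a b c x : 0 < c -> box_bump a b c x <= 1.
Proof.
move=> c0; apply: prodr_ile1 => i _; rewrite mulr_ge0 ?flat_ge0//=.
by rewrite mulr_ile1 ?flat_ge0 ?flat0_le1.
Qed.

Lemma box_bump_cvg a b x :
  box_bump a b k.+1%:R^-1 x @[k --> \oo] --> (\1_(open_box a b) x : R).
Proof.
suff -> : \1_(open_box a b) x = \prod_(i < d)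
    ((0 < x ord0 i - a ord0 i)%R%:R * (0 < b ord0 i - x ord0 i)%R%:R) :> R.
  apply: cvg_big => [|i _]; last by apply: cvgM; exact: flat0_cvg.
  exact: mul_continuous.
rewrite indicE; case: (boolP (x \in open_box a b)) => [|].
  rewrite inE => H; rewrite big1//= => i _.
  by have := H i; rewrite in_itv/= !subr_gt0 => /andP[-> ->]; rewrite mulr1.
move=> H; suff /existsP[i /negP Hi] : [exists i, x ord0 i \notin `]a ord0 i, b ord0 i[].
  rewrite (bigD1 i)//= !subr_gt0 -natrM mulnb; move: Hi; rewrite in_itv/= => /negP.
  by case: (_ && _) => //; rewrite mul0r.
apply: contraNT H => /existsPn H; rewrite inE => i.
by have := H i; rewrite negbK.
Qed.

Lemma box_bump_test (Omega : set 'rV[R]_d) a b c : 0 < c ->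
  closed_box a b `<=` Omega -> test_function Omega (box_bump a b c).
Proof.
move=> c0 abO; have S : closure [set x | box_bump a b c x != 0] `<=` closed_box a b.
  apply: (@subset_trans _ (closure (closed_box a b))).
    apply: closureS => x /=; rewrite /box_bump => /prodf_neq0 H i.
    have := H i isT; rewrite mulf_eq0 negb_or !flat_neq0 !subr_gt0 => /andP[ax xb].
    by rewrite in_itv/= !ltW.
  rewrite -(proj1 (closure_id _))//; apply: compact_closed; first exact: norm_hausdorff.
  exact: row_box_compact.
split.
- apply: flat_poly_smooth; apply: flat_poly_prod => i.
  apply: (@flat_poly_mul (fun x => flat 0%N c (x ord0 i - a ord0 i))
                         (fun x => flat 0%N c (b ord0 i - x ord0 i))).
  + have := flat_poly_atom 0%N 1 (a ord0 i) i c0.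
    by under eq_fun do rewrite mul1r.
  + have := flat_poly_atom 0%N (-1) (b ord0 i) i c0.
    by under eq_fun do rewrite mulN1r opprB.
- by apply: (subclosed_compact _ (@row_box_compact _ _ a b) S); exact: closed_closure.
- exact: subset_trans S abO.
Qed.

End smooth_functions.

(** * The fundamental lemma of the calculus of variations *)

Section fundamental_lemma.
Context {R : realType} (d : nat).
Implicit Types (a b : 'rV[R]_d) (H : 'rV[R]_d -> R) (Omega : set 'rV[R]_d).
Let mu := @lebesgue R d.

Lemma open_boxI a b a' b' : open_box a b `&` open_box a' b' =
  open_box (\row_i Num.max (a ord0 i) (a' ord0 i)) (\row_i Num.min (b ord0 i) (b' ord0 i)).
Proof.
apply/seteqP; split => [x [xab xab'] i|x H].
  have := xab i; have := xab' i; rewrite !in_itv/= !mxE => /andP[p q] /andP[r t].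
  by rewrite lt_min gt_max p q r t.
by split => i; have := H i; rewrite !in_itv/= !mxE lt_min gt_max => /andP[/andP[p q] /andP[r t]]; rewrite ?p ?q ?r ?t.
Qed.

Lemma ball_open_box (c : 'rV[R]_d) (r : R) : 0 < r ->
  ball c r = open_box (\row_i (c ord0 i - r)) (\row_i (c ord0 i + r)).
Proof.
move=> r0; apply/seteqP; split => [x [_ xr] i|x H].
  by have := xr ord0 i; rewrite /ball/= in_itv/= !mxE distrC ltr_distlC => /andP[]; lra.
split => // i j; rewrite (ord1 i); have := H j.
by rewrite in_itv/= !mxE /ball/= distrC ltr_distlC; lra.
Qed.

Lemma ball0 (c : 'rV[R]_d) (r : R) : r <= 0 -> ball c r = set0.
Proof. by move=> r0; apply/seteqP; split => // x []; rewrite ltNge r0. Qed.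

Definition open_boxes : set (set 'rV[R]_d) := [set B | exists a b, B = open_box a b].

(** Open boxes are stable under intersection, so this gives access to Dynkin induction. *)
Lemma open_boxes_generate : @measurable _ 'rV[R]_d = <<s open_boxes >>.
Proof.
have B c r : <<s open_boxes >> (ball c r : set 'rV[R]_d).
  have [r0|r0] := ltP 0 r; last by rewrite ball0//; exact: sigma_algebra0.
  apply: sub_sigma_algebra; rewrite ball_open_box//; by eexists; eexists.
apply/seteqP; split; last first.
  apply: smallest_sub; first exact: sigma_algebra_measurable.
  move=> _ [a [b ->]].
  rewrite (_ : open_box a b = \bigcap_(i in [set: 'I_d])
    ((fun x : 'rV[R]_d => x ord0 i) @^-1` `]a ord0 i, b ord0 i[)); last first.
    by apply/seteqP; split => [x /= h i _ |x h i] /=; [exact: h|exact: (h i I)].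
  apply: fin_bigcap_measurable => // i _.
  by rewrite -[X in measurable X]setTI; apply: measurable_coord_row.
apply: smallest_sub; first exact: smallest_sigma_algebra.
rewrite -bigcup_seq; apply: bigcup_sub => i _.
(* On [T'], the same space with the sigma-algebra of boxes, measurability of each coordinate is
   exactly the inclusion wanted. *)
pose T' : measurableType _ := g_sigma_algebraType open_boxes.
suff mf : measurable_fun [set: T'] (fun x : T' => (x : 'rV[R]_d) ord0 i).
  by move=> _ [Y mY <-]; exact: mf.
apply: (measurability _ (RGenOpens.measurableE R)) => //.
move=> _ [_ [a [b ->] <-]]; rewrite setTI.
have : open ((fun x : 'rV[R]_d => x ord0 i) @^-1` `]a, b[%classic).
  have /continuousP := @coord_continuous R 1 d ord0 i.
  by apply; exact: interval_open.
by move=> /open_row_cover[c [r [-> _]]]; apply: bigcupT_measurable => k; exact: B.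
Qed.

Lemma open_box_measurable a b : measurable (open_box a b).
Proof.
by rewrite open_boxes_generate; apply: sub_sigma_algebra; eexists; eexists.
Qed.

Section vanishing.
Variables (Omega : set 'rV[R]_d) (H : 'rV[R]_d -> R).
Hypothesis oO : open Omega.
Hypothesis iH : mu.-integrable Omega (EFin \o H).
Hypothesis H0 : forall psi, test_function Omega psi -> L2dot Omega H psi = 0.

Let mO : measurable Omega. Proof. exact: open_row_measurable. Qed.

(** The bumps lie in [[0, 1]] and tend pointwise to the indicator of the box, so dominated
    convergence with majorant [|H|] carries the vanishing over to the limit. *)
Lemma open_box_integral0 a b : closed_box a b `<=` Omega ->
  (\int[mu]_(x in open_box a b) (H x)%:E = 0)%E.
Proof.
move=> abO; pose w k : R := k.+1%:R^-1; have w0 k : 0 < w k by rewrite invr_gt0.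
pose f k x := (H x * box_bump a b (w k) x)%:E.
have mH : measurable_fun Omega H by apply/measurable_EFinP; exact: measurable_int iH.
have mB k : measurable_fun Omega (box_bump a b (w k)).
  apply: continuous_row_measurable => // x.
  have [sm _ _] := box_bump_test (w0 k) abO.
  exact: differentiable_continuous (sm [::] x).
have mf k : measurable_fun Omega (f k).
  by apply/measurable_EFinP; exact: measurable_funM.
have abO' : open_box a b `<=` Omega.
  by apply: subset_trans abO => x h i; have := h i; rewrite !in_itv/= => /andP[/ltW -> /ltW ->].
pose g x := (H x * \1_(open_box a b) x)%:E.
have mg : measurable_fun Omega g.
  apply/measurable_EFinP; apply: measurable_funM => //.
  by apply: measurable_funTS; exact: measurable_indic (open_box_measurable a b).
have cv : {ae mu, forall x, Omega x -> f ^~ x @ \oo --> g x}.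
  apply: aeW => x _; apply: cvg_EFin; first exact: nearW.
  by apply: cvgMl_tmp; exact: box_bump_cvg.
have ig : mu.-integrable Omega (abse \o (EFin \o H)) by exact: integrable_abse.
have fg : {ae mu, forall x n, Omega x -> (`|f n x| <= (abse \o (EFin \o H)) x)%E}.
  apply: aeW => x n _; rewrite /f /= lee_fin normrM -[leRHS]mulr1 ler_wpM2l//.
  by rewrite ger0_norm ?box_bump_ge0 ?box_bump_le1.
have [_ _ /=] := dominated_convergence mO mf mg cv ig fg.
have f0 k : (\int[mu]_(x in Omega) f k x = 0)%E.
  have ifk : mu.-integrable Omega (f k).
    by apply: le_integrable ig => // x Ox; rewrite /f /= lee_fin normr_id normrM
      -[leRHS]mulr1 ler_wpM2l// ger0_norm ?box_bump_ge0 ?box_bump_le1.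
  (* [L2dot] is only [fine] of the extended integral; integrability rules out that [fine] hides an
     infinite value. *)
  have := H0 (box_bump_test (w0 k) abO); rewrite /L2dot /Rintegral => h.
  by rewrite -[LHS]fineK ?h// integrable_fin_num.
under eq_fun do rewrite f0.
move=> cv0; have h := cvg_unique (@ereal_hausdorff R) cv0 (cvg_cst _).
rewrite (_ : open_box a b = Omega `&` open_box a b); last by rewrite setIidr.
rewrite integral_mkcondr -[RHS]h; apply: eq_integral => x _.
rewrite /g patchE indicE; case: ifP => _; by rewrite ?mulr1 ?mulr0.
Qed.

(** For a fixed box, the sets over whose trace on it [H] integrates to [0] form a Dynkin system
    containing all boxes. Restricting to the box keeps the intersected boxes inside [Omega]. *)
Lemma open_box_measure0 a b : closed_box a b `<=` Omega ->
  forall E, measurable E -> (\int[mu]_(x in E `&` open_box a b) (H x)%:E = 0)%E.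
Proof.
move=> abO; set Q := open_box a b.
have mQ : measurable Q by exact: open_box_measurable.
have QO : Q `<=` Omega.
  by apply: subset_trans abO => x h i; have := h i; rewrite !in_itv/= => /andP[/ltW -> /ltW ->].
have iQ : mu.-integrable Q (EFin \o H) by exact: integrableS iH.
move=> E mE; have : <<s open_boxes >> E by rewrite -open_boxes_generate.
apply: (dynkin_induction (P := fun E => (\int[mu]_(x in E `&` Q) (H x)%:E = 0)%E)).
- exact: open_boxes_generate.
- by move=> _ _ [a1 [b1 ->]] [a2 [b2 ->]]; rewrite open_boxI; do 2 eexists.
- by rewrite setTI; exact: open_box_integral0.
- move=> _ [a' [b' ->]]; rewrite open_boxI; apply: open_box_integral0.
  apply: subset_trans abO => x h i; have := h i.
  by rewrite !in_itv/= !mxE le_min ge_max => /andP[/andP[_ ->] /andP[_ ->]].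
- move=> S mS S0.
  have := open_box_integral0 abO.
  rewrite -/Q -[in X in X -> _](setTI Q) -(setUv S) setIUl integral_setU_EFin//.
  + by rewrite S0 add0e.
  + exact: measurableI.
  + by apply: measurableI => //; exact: measurableC.
  + rewrite -setIUl setUv setTI; apply/measurable_EFinP; exact: measurable_int iQ.
  + apply/disj_setPS => x [[Sx _] [nSx _]]; exact: nSx.
- move=> F mF tF F0; rewrite setI_bigcupl integral_bigcup.
  + by rewrite eseries0.
  + by apply: trivIset_setIr.
  + by move=> k; exact: measurableI.
  + by rewrite -setI_bigcupl; apply: integrableS iQ => //; apply: measurableI => //; exact: bigcupT_measurable.
Qed.

Lemma fundamental_lemma : ae_eq mu Omega (EFin \o H) (cst 0%E).
Proof.
have [c [r [OE cO]]] := open_row_cover oO.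
have aek k : ae_eq mu (ball (c k) (r k)) (EFin \o H) (cst 0%E).
  have [r0|r0] := ltP 0 (r k); last first.
    by apply: aeW => x; rewrite ball0.
  have cbO : closed_box (\row_i (c k ord0 i - r k)) (\row_i (c k ord0 i + r k)) `<=` Omega.
    move=> x h; apply: (cO k) => // i; have := h i.
    by rewrite in_itv/= !mxE ler_distlC; lra.
  rewrite ball_open_box//; apply: integral_ae_eq => //.
  - exact: open_box_measurable.
  - apply: integrableS iH => //; first exact: open_box_measurable.
    by apply: subset_trans cbO => x h i; have := h i; rewrite !in_itv/= => /andP[/ltW -> /ltW ->].
  - move=> E EQ mE; rewrite integral0 -[RHS](open_box_measure0 cbO mE).
    by rewrite setIidl.
have := negligible_bigcup aek; apply: negligibleS.
rewrite OE => x /= /not_implyP[[k _ xk] nx]; exists k => //= h.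
exact/nx/h.
Qed.
End vanishing.
End fundamental_lemma.

(** * Weak gradients and the energy *)

Section weak_gradients.
Context {R : realType} (d : nat) (Omega : set 'rV[R]_d).
Hypothesis oO : open Omega.
Hypothesis bO : bounded_set Omega.
Implicit Types (v w p : 'rV[R]_d -> R) (G : 'rV[R]_d -> 'rV[R]_d).
Let mu := @lebesgue R d.

Let mO : measurable Omega. Proof. exact: open_row_measurable. Qed.

Let fO : (mu Omega < +oo)%E. Proof. exact: lebesgue_bounded. Qed.

Lemma L2_mul_integrable v w : L2 Omega v -> L2 Omega w ->
  mu.-integrable Omega (EFin \o (fun x => v x * w x)).
Proof.
move=> [mv iv] [mw iw].
apply: (le_integrable mO _ _ (integrableD mO iv iw)).
  by apply/measurable_EFinP; exact: measurable_funM.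
move=> x _ /=; rewrite lee_fin normrM [leRHS]ger0_norm ?addr_ge0 ?sqr_ge0//.
rewrite -(real_normK (num_real (v x))) -(real_normK (num_real (w x))).
have := sqr_ge0 (`|v x| - `|w x|).
have := mulr_ge0 (normr_ge0 (v x)) (normr_ge0 (w x)).
by move: `|v x| `|w x| => a b; nra.
Qed.

Lemma L2_lin c v w : L2 Omega v -> L2 Omega w -> L2 Omega (fun x => c * v x + w x).
Proof.
move=> [mv iv] [mw iw]; split; first by apply: measurable_funD => //; exact: measurable_funM.
have := integrableD mO (integrableZl mO (2 * c ^+ 2) iv) (integrableZl mO 2 iw).
apply: le_integrable => //.
  apply/measurable_EFinP; apply: measurable_funX.
  by apply: measurable_funD => //; exact: measurable_funM.
move=> x _ /=; rewrite lee_fin ger0_norm ?sqr_ge0// [leRHS]ger0_norm; last first.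
  by rewrite addr_ge0// mulr_ge0 ?sqr_ge0// mulr_ge0 ?sqr_ge0.
by have := sqr_ge0 (c * v x - w x); nra.
Qed.

Lemma bounded_L2 v M : measurable_fun Omega v -> (forall x, Omega x -> `|v x| <= M) ->
  L2 Omega v.
Proof.
move=> mv vM; split => //; apply: measurable_bounded_integrable => //.
  exact: measurable_funX.
exists (M ^+ 2); split; first exact: num_real.
move=> N MN x Ox /=; apply: le_trans (ltW MN).
by rewrite normrX lerXn2r ?nnegrE ?(le_trans _ (vM x Ox))// vM.
Qed.

Lemma L2_integrable v : L2 Omega v -> mu.-integrable Omega (EFin \o v).
Proof.
move=> Lv; have L1 : L2 Omega (cst 1).
  by apply: (@bounded_L2 _ 1) => // x _; rewrite normr1.
by have := L2_mul_integrable Lv L1; under eq_fun do rewrite mulr1.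
Qed.

Lemma continuous_L2 v : continuous v -> L2 Omega v.
Proof.
move=> cv; have [a [b [_ Oab]]] := bounded_subset_box bO.
set K := (X in _ `<=` X) in Oab.
have [M [_ HM]] : bounded_set (v @` K).
  apply: compact_bounded; apply: continuous_compact; last exact: row_box_compact.
  exact: continuous_subspaceT.
apply: (@bounded_L2 _ (M + 1)); first exact: continuous_row_measurable.
move=> x Ox; apply: (HM (M + 1)); first by rewrite ltrDl.
by exists x => //; exact: Oab.
Qed.

Lemma test_function_L2 psi : test_function Omega psi -> L2 Omega psi.
Proof.
move=> [sp _ _]; apply: continuous_L2 => x.
exact: differentiable_continuous (sp [::] x).
Qed.

Lemma partial_test_function_L2 psi j : test_function Omega psi ->
  L2 Omega (partial j psi).
Proof.
move=> [sp _ _]; apply: continuous_L2 => x.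
exact: differentiable_continuous (sp [:: j] x).
Qed.

Lemma eq_weak_gradient v w G : {in Omega, v =1 w} ->
  is_weak_gradient Omega v G -> is_weak_gradient Omega w G.
Proof.
move=> vw Gv j; have [LG h] := Gv j; split => // psi tp; rewrite -h//.
by apply: eq_Rintegral => x xO; rewrite vw.
Qed.

Lemma L2dot_lin c v w p : L2 Omega v -> L2 Omega w -> L2 Omega p ->
  L2dot Omega (fun x => c * v x + w x) p = c * L2dot Omega v p + L2dot Omega w p.
Proof.
move=> Lv Lw Lp; have ivp := L2_mul_integrable Lv Lp; have iwp := L2_mul_integrable Lw Lp.
rewrite /L2dot -RintegralZl// -RintegralD//.
  by apply: eq_Rintegral => x _; ring.
have := integrableZl mO c ivp; apply: eq_integrable => // x _ /=.
Qed.

Lemma weak_gradient_lin c v w G G' : L2 Omega v -> L2 Omega w ->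
  is_weak_gradient Omega v G -> is_weak_gradient Omega w G' ->
  is_weak_gradient Omega (fun x => c * v x + w x) (fun x => c *: G x + G' x).
Proof.
move=> Lv Lw Gv Gw j; have [LG hv] := Gv j; have [LG' hw] := Gw j.
have E : (fun x => (c *: G x + G' x) ord0 j) = (fun x => c * G x ord0 j + G' x ord0 j).
  by apply/funext => x; rewrite !mxE.
rewrite E; split; first exact: L2_lin.
move=> psi tp; have Lp := test_function_L2 tp.
rewrite !L2dot_lin//; last exact: partial_test_function_L2.
by rewrite hv// hw//; ring.
Qed.

Lemma weak_gradient_unique v G G' :
  is_weak_gradient Omega v G -> is_weak_gradient Omega v G' ->
  {ae mu, forall x, Omega x -> G x = G' x}.
Proof.
move=> Gv Gw.
have : \forall x \ae mu, forall j : 'I_d, Omega x -> G x ord0 j = G' x ord0 j.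
  apply: filter_forall => j; have [LG hv] := Gv j; have [LG' hw] := Gw j.
  have LD := L2_lin (-1) LG' LG.
  have := @fundamental_lemma R d Omega _ oO (L2_integrable LD).
  have h psi : test_function Omega psi -> L2dot Omega (fun x => - 1 * G' x ord0 j + G x ord0 j) psi = 0.
    move=> tp; rewrite L2dot_lin//; last exact: test_function_L2.
    by apply/eqP; rewrite mulN1r addrC subr_eq0 -eqr_opp -hv// -hw.
  move=> /(_ h); apply: filterS => x /= H /H[] /eqP.
  by rewrite mulN1r addrC subr_eq0 => /eqP.
by apply: filterS => x H Ox; apply/rowP => j; exact: H.
Qed.

Lemma grad_spec v : H1 Omega v -> is_weak_gradient Omega v (grad Omega v).
Proof. by move=> [_ [G HG]]; apply: (@getPex _ (is_weak_gradient Omega v)); exists G. Qed.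

Lemma H1_lin c v w : H1 Omega v -> H1 Omega w -> H1 Omega (fun x => c * v x + w x).
Proof.
move=> [Lv [G Gv]] [Lw [G' Gw]]; split; first exact: L2_lin.
by exists (fun x => c *: G x + G' x); exact: weak_gradient_lin.
Qed.

Lemma H1_0 : H1 Omega (fun=> 0).
Proof.
have L0 : L2 Omega (fun=> 0) by apply: (@bounded_L2 _ 0) => // x _; rewrite normr0.
have D0 p : L2dot Omega (fun=> 0) p = 0.
  by rewrite /L2dot; under eq_Rintegral do rewrite mul0r; rewrite Rintegral_cst// mul0r.
split => //; exists (fun=> 0) => j.
rewrite (_ : (fun _ => _) = (fun=> 0)); last by apply/funext => x; rewrite mxE.
by split => // psi _; rewrite !D0 oppr0.
Qed.

(** [grad] is an arbitrary choice, so linearity holds only almost everywhere. Since [u] need agree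
    with the combination only on [Omega], the case [c = 0] also serves as a congruence rule. *)
Lemma grad_lin c u v w : H1 Omega u -> H1 Omega v -> H1 Omega w ->
  (forall x, Omega x -> u x = c * v x + w x) ->
  {ae mu, forall x, Omega x -> grad Omega u x = c *: grad Omega v x + grad Omega w x}.
Proof.
move=> hu hv hw E; apply: (@weak_gradient_unique u); first exact: grad_spec.
apply: (@eq_weak_gradient (fun x => c * v x + w x)).
  by move=> x /[!inE] /E.
by apply: weak_gradient_lin; [case: hv|case: hw|exact: grad_spec|exact: grad_spec].
Qed.

Section energy.
Variable A : 'rV[R]_d -> R.
Hypothesis mA : measurable_fun Omega A.
Hypothesis bA : exists M, forall x, Omega x -> `|A x| <= M.

Lemma energyC v w : energy Omega A v w = energy Omega A w v.
Proof.
apply: eq_Rintegral => x _; rewrite /dotr; apply: eq_bigr => j _; rewrite !mxE; ring.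
Qed.

Lemma energy_ge0 v : (forall x, Omega x -> 0 <= A x) -> 0 <= energy Omega A v v.
Proof.
move=> A0; apply: Rintegral_ge0 => x Ox; apply: sumr_ge0 => j _.
by rewrite mxE -mulrA mulr_ge0 ?A0// -expr2 sqr_ge0.
Qed.

Lemma energy_integrable v w : H1 Omega v -> H1 Omega w ->
  mu.-integrable Omega (EFin \o (fun x => dotr (A x *: grad Omega v x) (grad Omega w x))).
Proof.
move=> /grad_spec Gv /grad_spec Gw.
have [M AM] := bA.
have : mu.-integrable Omega (fun x => \sum_(j < d) (A x * (grad Omega v x ord0 j * grad Omega w x ord0 j))%:E)%E.
  apply: integrable_sum => // j _.
  have bA' : [bounded A x | x in Omega].
    exists M; split; first exact: num_real.
    by move=> N MN x Ox; apply: le_trans (ltW MN); exact: AM.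
  have [Lv _] := Gv j; have [Lw _] := Gw j.
  exact: (integrableMr mO mA bA' (L2_mul_integrable Lv Lw)).
apply: eq_integrable => // x _ /=; rewrite /dotr sumEFin; congr EFin.
by apply: eq_bigr => j _; rewrite mxE mulrA.
Qed.

Lemma energy_lin c u v w p : H1 Omega u -> H1 Omega v -> H1 Omega w -> H1 Omega p ->
  (forall x, Omega x -> u x = c * v x + w x) ->
  energy Omega A u p = c * energy Omega A v p + energy Omega A w p.
Proof.
move=> hu hv hw hp E.
have iu := energy_integrable hu hp; have iv := energy_integrable hv hp.
have iw := energy_integrable hw hp.
have icv := integrableZl mO c iv.
rewrite /energy -RintegralZl// -RintegralD//.
congr fine; apply: ae_eq_integral => //.
- exact: measurable_int iu.
- exact: measurable_int (integrableD mO icv iw).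
have := grad_lin hu hv hw E; apply: filterS => x H Ox; rewrite (H Ox).
congr EFin; rewrite /dotr big_distrr -big_split/=; apply: eq_bigr => j _.
by rewrite !mxE; ring.
Qed.

Lemma H1_sum (I : Type) (s : seq I) (c : I -> R) (phi : I -> 'rV[R]_d -> R) :
  (forall i, H1 Omega (phi i)) -> H1 Omega (fun x => \sum_(i <- s) c i * phi i x).
Proof.
move=> hphi; elim: s => [|i s IH].
  by under eq_fun do rewrite big_nil; exact: H1_0.
by under eq_fun do rewrite big_cons; exact: H1_lin.
Qed.

Lemma energy_sum (I : Type) (s : seq I) (c : I -> R) (phi : I -> 'rV[R]_d -> R) p :
  (forall i, H1 Omega (phi i)) -> H1 Omega p ->
  energy Omega A (fun x => \sum_(i <- s) c i * phi i x) p =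
  \sum_(i <- s) c i * energy Omega A (phi i) p.
Proof.
move=> hphi hp; elim: s => [|i s IH].
  have h0 : H1 Omega (fun x => \sum_(i <- [::]) c i * phi i x) by exact: H1_sum.
  (* The empty sum [u] satisfies [u = 1 * u + u], so its energy against [p] equals twice itself and
     is [0]. *)
  have h := @energy_lin 1 _ _ _ p h0 h0 h0 hp.
  rewrite big_nil; apply: (addIr (energy Omega A (fun x => \sum_(i <- [::]) c i * phi i x) p)).
  by rewrite add0r [RHS]h ?mul1r// => x _; rewrite !big_nil; ring.
rewrite big_cons -IH; apply: energy_lin => //; try exact: H1_sum.
by move=> x _; rewrite big_cons.
Qed.

End energy.
End weak_gradients.

(** * Piecewise affine functions *)

Section simplices.
Context {R : realType} (d : nat) (T : mesh R d).
Implicit Types (K : {set 'I_(nvtx T)}) (v w : 'rV[R]_d -> R) (x y : 'rV[R]_d).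

Lemma vtx_cell K a : a \in K -> cell K (vtx a).
Proof.
move=> aK; exists (fun b => (b == a)%:R); split.
- by move=> b; exact: ler0n.
- by move=> b bK; case: eqP bK => [->|//]; rewrite aK.
- by rewrite (bigD1 a)//= eqxx big1 ?addr0// => b /negbTE ->.
- rewrite (bigD1 a)//= eqxx scale1r big1 ?addr0// => b /negbTE ->.
  by rewrite scale0r.
Qed.

Lemma dotr_sumr (I : Type) (s : seq I) (al : 'rV[R]_d) (c : I -> R) (p : I -> 'rV[R]_d) :
  dotr al (\sum_(i <- s) c i *: p i) = \sum_(i <- s) c i * dotr al (p i).
Proof.
rewrite /dotr; under [RHS]eq_bigr do rewrite big_distrr.
rewrite exchange_big; apply: eq_bigr => j _ /=.
rewrite summxE big_distrr; apply: eq_bigr => i _ /=.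
by rewrite mxE; ring.
Qed.

Lemma P1_barycentric K v (c : 'I_(nvtx T) -> R) : P1_on (cell K) v ->
  (forall a, 0 <= c a) -> (forall a, a \notin K -> c a = 0) -> \sum_a c a = 1 ->
  v (\sum_a c a *: vtx a) = \sum_a c a * v (vtx a).
Proof.
move=> [al [be vE]] c0 cK c1; rewrite vE; last by exists c.
rewrite dotr_sumr -[be]mulr1 -c1 big_distrr -big_split; apply: eq_bigr => a _ /=.
have [aK|/cK ->] := boolP (a \in K); last by rewrite !mul0r mulr0 addr0.
by rewrite (vE _ (vtx_cell aK)); ring.
Qed.

Definition piecewise_P1 v := forall K, K \in simplices T -> P1_on (cell K) v.

Lemma piecewise_P1_eq v w K x : piecewise_P1 v -> piecewise_P1 w ->
  K \in simplices T -> (forall a : 'I_(nvtx T), v (vtx a) = w (vtx a)) -> cell K x -> v x = w x.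
Proof.
move=> pv pw KT vw [c [c0 cK c1 ->]].
rewrite (P1_barycentric (pv K KT))// (P1_barycentric (pw K KT))//.
by apply: eq_bigr => a _; rewrite vw.
Qed.

Lemma piecewise_P1_lin c v w : piecewise_P1 v -> piecewise_P1 w ->
  piecewise_P1 (fun x => c * v x + w x).
Proof.
move=> pv pw K KT; have [al [be vE]] := pv K KT; have [al' [be' wE]] := pw K KT.
exists (c *: al + al'), (c * be + be') => x xK; rewrite vE// wE//.
rewrite (_ : dotr (_ + _) x = c * dotr al x + dotr al' x); first by ring.
rewrite /dotr big_distrr -big_split; apply: eq_bigr => j _ /=.
by rewrite !mxE; ring.
Qed.

Lemma piecewise_P1_sum (I : Type) (s : seq I) (c : I -> R) (phi : I -> 'rV[R]_d -> R) :
  (forall i, piecewise_P1 (phi i)) -> piecewise_P1 (fun x => \sum_(i <- s) c i * phi i x).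
Proof.
move=> pphi; elim: s => [|i s IH].
  under eq_fun do rewrite big_nil.
  move=> K KT; exists 0, 0 => x _; rewrite addr0 /dotr big1// => j _.
  by rewrite mxE mul0r.
by under eq_fun do rewrite big_cons; exact: piecewise_P1_lin.
Qed.

(** Convex combinations of the vertices with the weight of vertex [a] capped by [u a]. Caps [1] on
    [K] and [0] elsewhere give [cell K]; lowering one cap cuts out a sublevel set of a hat
    function. *)
Definition weighted_points (u : 'rV[R]_(nvtx T)) : set 'rV[R]_d :=
  [set \sum_a W ord0 a *: vtx a | W in
    [set W : 'rV[R]_(nvtx T) | (forall a, W ord0 a \in `[(0 : 'rV[R]_(nvtx T)) ord0 a, u ord0 a]) /\
      \sum_a W ord0 a = 1]].

Lemma weighted_points_closed u : closed (weighted_points u).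
Proof.
apply: compact_closed; first exact: norm_hausdorff.
have cc (a : 'I_(nvtx T)) : continuous (fun W : 'rV[R]_(nvtx T) => W ord0 a).
  exact: coord_continuous.
apply: continuous_compact.
  apply: continuous_subspaceT; apply: continuous_big => [|a _]; first exact: add_continuous.
  by move=> W; apply: (@cvgZr_tmp _ _ _ (nbhs W)); exact: cc.
apply: (@compact_closedI _ [set W : 'rV[R]_(nvtx T) | forall a, W ord0 a \in `[(0 : 'rV[R]_(nvtx T)) ord0 a, u ord0 a]]
  [set W : 'rV[R]_(nvtx T) | \sum_a W ord0 a = 1]); first exact: row_box_compact.
have /continuous_closedP : continuous (fun W : 'rV[R]_(nvtx T) => \sum_a W ord0 a).
  by apply: continuous_big => [|a _]; [exact: add_continuous|exact: cc].
by move=> /(_ [set 1]); apply; exact: closed_eq.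
Qed.

(* The homothety of ratio [t] centred at the interior vertex [a] moves a point [x] into
   [Omega]; near the image the hat function exceeds [1 - t], so undoing the
   homothety there never leaves the simplices containing [a]. *)
Lemma hat_function_bdry (Omega : set 'rV[R]_d) phi (a : 'I_(nvtx T)) :
  open Omega -> interior (closure Omega) = Omega ->
  closure Omega = \bigcup_(K in [set` simplices T]) cell K ->
  piecewise_P1 phi -> (forall b : 'I_(nvtx T), phi (vtx b) = (b == a)%:R) ->
  Omega (vtx a) -> forall x, bdry Omega x -> phi x = 0.
Proof.
move=> oO OE cover pphi phiE Oa x [cx nx].
have sum_delta (c : 'I_(nvtx T) -> R) : \sum_b c b * (b == a)%:R = c a.
  by rewrite (bigD1 a)//= eqxx mulr1 big1 ?addr0// => b /negbTE ->; rewrite mulr0.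
have phiW K (c : 'I_(nvtx T) -> R) : K \in simplices T ->
    (forall b, 0 <= c b) -> (forall b, b \notin K -> c b = 0) -> \sum_b c b = 1 ->
    phi (\sum_b c b *: vtx b) = c a.
  move=> KT c0 cK c1; rewrite (P1_barycentric (pphi K KT))//.
  by under eq_bigr do rewrite phiE.
have := cx; rewrite cover => -[K /= KT [w [w0 wK w1 xE]]].
have phix : phi x = w a by rewrite xE (phiW K).
(* If the weight [w a] were nonzero, [x] would be interior to [closure Omega], hence in [Omega]. *)
apply: contrapT => /eqP; rewrite phix => wa0; apply: nx.
rewrite (proj1 (interior_id _) oO) -OE.
have {}wa0 : 0 < w a by rewrite lt_neqAle eq_sym wa0 w0.
have aK : a \in K by apply: contraLR wa0 => /wK ->; rewrite ltxx.
pose h t y : 'rV[R]_d := vtx a + t *: (y - vtx a).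
have [t [t0 t1 Ot]] : exists t : R, [/\ 0 < t, t <= 1 & Omega (h t x)].
  have ch : continuous (fun t : R => h t x).
    move=> s; apply: cvgD; first exact: cvg_cst.
    by apply: cvgZr_tmp; exact: cvg_id.
  have : nbhs 0 ((fun t : R => h t x) @^-1` Omega).
    apply: ch; rewrite /h scale0r addr0; exact: open_nbhs_nbhs.
  move=> /nbhs_ballP[e /= e0 he]; exists (Num.min (e / 2) 1).
  have m0 : 0 < Num.min (e / 2) 1 by rewrite lt_min divr_gt0//=.
  split => //; first by rewrite ge_min lexx orbT.
  apply: he; rewrite /ball/= sub0r normrN gtr0_norm// gt_min; apply/orP; left.
  by rewrite ltr_pdivrMr// ltr_pMr// ltr1n.
pose wt b := t * w b + (1 - t) * (b == a)%:R.
have comb (c : 'I_(nvtx T) -> R) s r : \sum_b (s * c b + r * (b == a)%:R) *: vtx b =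
    s *: (\sum_b c b *: vtx b) + r *: vtx a.
  under eq_bigr do rewrite scalerDl -scalerA; rewrite big_split/= -scaler_sumr; congr (_ + _).
  rewrite (bigD1 a)//= eqxx mulr1 big1 ?addr0// => b /negbTE ->.
  by rewrite mulr0 scale0r.
have comb1 (c : 'I_(nvtx T) -> R) s r : \sum_b c b = 1 ->
    \sum_b (s * c b + r * (b == a)%:R) = s + r.
  by move=> c1; rewrite big_split/= -mulr_sumr c1 mulr1 (sum_delta (fun=> r)).
have htx : h t x = \sum_b wt b *: vtx b.
  by rewrite /wt comb -xE /h; apply/rowP => j; rewrite !mxE; ring.
have phit : 1 - t < phi (h t x).
  rewrite htx (phiW K)//.
  - by rewrite /wt eqxx mulr1 ltrDr mulr_gt0.
  - by move=> b; rewrite /wt addr_ge0// mulr_ge0 ?ler0n ?w0 ?subr_ge0// ltW.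
  - move=> b bK; rewrite /wt wK// mulr0 add0r; case: eqP bK => [->|_ _]; first by rewrite aK.
    by rewrite mulr0.
  - by rewrite /wt comb1// addrC subrK.
(* [bad] is the part of the cells where [phi] is at most [1 - t]. The [min] keeps the cap of [a] at
   [0] in cells without [a]. *)
pose u K' : 'rV[R]_(nvtx T) := \row_b (if b == a then Num.min (a \in K')%:R (1 - t) else (b \in K')%:R).
pose bad := \bigcup_(K' in [set` simplices T]) weighted_points (u K').
have cbad : closed bad.
  by apply: closed_bigcup => // K' _; exact: weighted_points_closed.
have nbad : ~ bad (h t x).
  move=> [K' /= K'T [W [Wu W1] hE]]; move: phit; rewrite -hE (phiW K' (fun b => W ord0 b))//.
  - by have := Wu a; rewrite in_itv/= !mxE eqxx le_min => /andP[_ /andP[_]]; rewrite leNgt => /negbTE ->.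
  - by move=> b; have := Wu b; rewrite in_itv/= mxE => /andP[].
  - move=> b bK'; have := Wu b; rewrite in_itv/= !mxE => /andP[p q].
    apply/eqP; rewrite eq_le p andbT; move: q; case: eqP => [ba|_]; rewrite ?le_min.
      by move=> /andP[+ _]; rewrite -ba (negbTE bK').
    by rewrite (negbTE bK').
have ch : continuous (h t).
  move=> y; have cy : (fun y => y - vtx a) @ nbhs y --> y - vtx a.
    by apply: (@cvgB _ _ _ (nbhs y)); [exact: cvg_id|exact: cvg_cst].
  have := @cvgD _ _ _ (nbhs y) _ _ _ _ _ (cvg_cst (vtx a)) (cvgZl_tmp (k := t) cy).
  exact.
have : nbhs x (h t @^-1` (Omega `&` ~` bad)).
  apply: ch; apply: open_nbhs_nbhs; split => //.
  by apply: openI => //; exact: closed_openC.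
rewrite /interior /=; apply: filterS => y [/= Oy nby].
have := subset_closure Oy; rewrite cover => -[K' /= K'T [c [c0 cK' c1 yE]]].
have ca : 1 - t < c a.
  rewrite ltNge; apply/negP => cat; apply: nby; exists K' => //.
  exists (\row_b c b); last by rewrite yE; apply: eq_bigr => b _; rewrite mxE.
  split; last by rewrite -c1; apply: eq_bigr => b _; rewrite mxE.
  move=> b; rewrite in_itv/= !mxE c0/=.
  have cb : c b <= (b \in K')%:R.
    have [bK'|/cK' ->//] := boolP (b \in K').
    by rewrite -c1 (bigD1 b)//= lerDl sumr_ge0.
  by case: eqP cb => [->|//] cb; rewrite le_min cb cat.
have aK' : a \in K'.
  apply: contraT => /cK' c0'; move: ca; rewrite c0' ltNge subr_ge0 t1 //.
(* These are the barycentric weights of [y], obtained by inverting the homothety. Only the weight at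
   [a] could turn negative; it equals [(c a - (1 - t)) / t], positive by [ca]. *)
exists K' => //; exists (fun b => t^-1 * c b + (1 - t^-1) * (b == a)%:R).
have tn0 : t != 0 by rewrite gt_eqF.
split.
- move=> b; have [->|_] := eqVneq b a; last by rewrite mulr0 addr0 mulr_ge0// invr_ge0 ltW.
  rewrite mulr1 -(pmulr_rge0 _ t0) mulrDr mulrA mulfV// mul1r mulrBr mulfV// mulr1.
  by rewrite ltW//; lra.
- move=> b bK'; rewrite cK'// mulr0 add0r; case: eqP bK' => [->|_ _]; first by rewrite aK'.
  by rewrite mulr0.
- by rewrite comb1// addrC subrK.
- by rewrite comb -yE /h; apply/rowP => j; rewrite !mxE; field.
Qed.

End simplices.

(** * The stiffness matrix *)

Section stiffness_matrix.
Context {R : realType} (d : nat) (Omega : set 'rV[R]_d) (T : mesh R d).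
Variables (A : 'rV[R]_d -> R) (n : nat) (z : 'I_n -> 'I_(nvtx T)).
Variable phi : 'I_n -> 'rV[R]_d -> R.
Hypothesis hOmega : polyhedral_domain Omega.
Hypothesis hT : triangulation Omega T.
Hypothesis hA : piecewise_constant Omega T A.
Hypothesis hz : interior_vertices Omega z.
Hypothesis hphi : nodal_basis Omega z phi.
Implicit Types (c : 'cV[R]_n) (v p : 'rV[R]_d -> R).

Let oO : open Omega. Proof. by case: hOmega. Qed.
Let bO : bounded_set Omega. Proof. by case: hOmega. Qed.
Let mA : measurable_fun Omega A. Proof. by case: hA. Qed.
Let bA : exists M, forall x, Omega x -> `|A x| <= M. Proof. by case: hA. Qed.

Lemma vtx_bdry a : ~ Omega (@vtx R d T a) -> bdry Omega (vtx a).
Proof.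
move=> na; have [_ tv _ _ cover] := hT; have [K KT aK] := tv a.
split; last by rewrite (proj1 (interior_id _) oO).
by rewrite cover; exists K => //; exact: vtx_cell.
Qed.

Lemma nodal_basis_bdry i : S1_bc Omega T (fun=> 0) (phi i).
Proof.
have [Sphi phiE] := hphi i; split => // x bx.
have [_ _ _ _ cover] := hT; have [_ _ _ _ OE] := hOmega.
apply: (hat_function_bdry oO OE cover (a := z i) _ _ _ bx) => //; first by case: Sphi.
by apply/(proj2 hz); exists i.
Qed.

Lemma H1_B v w : H1 Omega v -> H1 Omega w -> H1 Omega (v \- w).
Proof.
move=> hv hw; have := H1_lin oO bO (-1) hw hv.
by rewrite (_ : (fun x => _) = v \- w)//; apply/funext => x /=; ring.
Qed.

Lemma piecewise_P1_B v w : piecewise_P1 T v -> piecewise_P1 T w ->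
  piecewise_P1 T (v \- w).
Proof.
move=> hv hw; have := piecewise_P1_lin (-1) hw hv.
by rewrite (_ : (fun x => _) = v \- w)//; apply/funext => x /=; ring.
Qed.

Lemma nodal_expansion v c : piecewise_P1 T v ->
  (forall a : 'I_(nvtx T), ~ Omega (vtx a) -> v (vtx a) = 0) ->
  (forall i, v (vtx (z i)) = c i ord0) ->
  forall x, Omega x -> v x = \sum_i c i ord0 * phi i x.
Proof.
move=> pv v0 vz x Ox; have [_ _ _ _ cover] := hT.
have := subset_closure Ox; rewrite cover => -[K /= KT xK].
have pphi i : piecewise_P1 T (phi i) by have [[]] := hphi i.
apply: (@piecewise_P1_eq _ _ _ v _ K x pv (piecewise_P1_sum _ (fun i => c i ord0) pphi)) => // a.
under eq_bigr do rewrite (proj2 (hphi _)).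
have [injz hza] := hz.
have [/hza[i <-]|na] := pselect (Omega (vtx a)).
  rewrite vz (bigD1 i)//= eqxx mulr1 big1 ?addr0// => j ji.
  by rewrite (inj_eq injz) eq_sym (negbTE ji) mulr0.
rewrite v0// big1// => i _; case: eqP => [E|_]; last by rewrite mulr0.
by case: na; apply/hza; exists i.
Qed.

Lemma energy_expansion v p c : H1 Omega v -> H1 Omega p ->
  (forall x, Omega x -> v x = \sum_i c i ord0 * phi i x) ->
  energy Omega A v p = \sum_i c i ord0 * energy Omega A (phi i) p.
Proof.
move=> hv hp vE; have Hphi i : H1 Omega (phi i) by have [[]] := hphi i.
rewrite -(energy_sum oO bO mA bA _ (fun i => c i ord0) Hphi hp).
have Hs := H1_sum oO bO (index_enum 'I_n) (fun i => c i ord0) Hphi.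
rewrite (energy_lin oO bO mA bA (c := 0) hv Hs Hs hp) ?mul0r ?add0r// => x Ox.
by rewrite mul0r add0r vE.
Qed.

Lemma stiffness_energy v c : H1 Omega v ->
  (forall x, Omega x -> v x = \sum_i c i ord0 * phi i x) ->
  forall i, (stiffness Omega A phi *m c) i ord0 = energy Omega A v (phi i).
Proof.
move=> hv vE i; have [[Hi _] _] := hphi i.
rewrite (energy_expansion hv Hi vE) mxE; apply: eq_bigr => j _.
by rewrite mxE mulrC.
Qed.

Lemma dotc_stiffness v c : H1 Omega v ->
  (forall x, Omega x -> v x = \sum_i c i ord0 * phi i x) ->
  dotc (stiffness Omega A phi *m c) c = energy Omega A v v.
Proof.
move=> hv vE; rewrite (energy_expansion hv hv vE) /dotc; apply: eq_bigr => i _.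
by rewrite (stiffness_energy hv vE) energyC mulrC.
Qed.

Lemma stiffness_sym : (stiffness Omega A phi)^T = stiffness Omega A phi.
Proof. by apply/matrixP => i j; rewrite !mxE energyC. Qed.

Lemma stiffness_psd c : (forall x, Omega x -> 0 < A x) ->
  0 <= dotc (stiffness Omega A phi *m c) c.
Proof.
move=> A0; have Hphi i : H1 Omega (phi i) by have [[]] := hphi i.
have Hs := H1_sum oO bO (index_enum 'I_n) (fun i => c i ord0) Hphi.
rewrite (dotc_stiffness Hs)//; apply: energy_ge0 => x Ox; exact/ltW/A0.
Qed.

Lemma normA_stiffness v c : S1 Omega T v ->
  (forall a : 'I_(nvtx T), ~ Omega (vtx a) -> v (vtx a) = 0) ->
  (forall i, v (vtx (z i)) = c i ord0) ->
  normA (stiffness Omega A phi) c = energy_norm Omega A v.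
Proof.
move=> [hv pv] v0 vz; rewrite /normA /energy_norm.
by rewrite (dotc_stiffness hv (nodal_expansion pv v0 vz)).
Qed.

(** The difference [uT - gh] vanishes at the boundary vertices and keeps the interior nodal values
    of [uT], so it expands in the basis; testing with [phi i] gives row [i]. *)
Lemma fe_solution_coeff f g gh uT : boundary_lift Omega T g gh ->
  fe_solution Omega T A f g uT ->
  stiffness Omega A phi *m (\col_i uT (vtx (z i))) = load Omega A f gh phi.
Proof.
move=> [[Hgh Pgh] ghb ghi] [[[HuT PuT] uTb] uTE].
have HD := H1_B HuT Hgh.
have E := nodal_expansion (c := \col_i uT (vtx (z i))) (piecewise_P1_B PuT Pgh).
apply/matrixP => i j; rewrite (ord1 j) (stiffness_energy HD) ?mxE.
  have [[Hi _] _] := hphi i.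
  rewrite -(uTE _ (nodal_basis_bdry i)).
  rewrite (energy_lin oO bO mA bA (c := 1) HuT HD Hgh Hi) ?mul1r ?addrK// => x _ /=.
  by rewrite mul1r subrK.
apply: E => [a na|k] /=.
  by have ba := vtx_bdry na; rewrite uTb// ghb// subrr.
by rewrite mxE ghi ?subr0//; apply/(proj2 hz); exists k.
Qed.

(** The common boundary values cancel, so the difference is a combination of interior hat
    functions. *)
Lemma normA_fe_functions g v w c c' : fe_function Omega z g c v ->
  fe_function Omega z g c' w ->
  normA (stiffness Omega A phi) (c - c') = energy_norm Omega A (v \- w).
Proof.
move=> [[[Hv Pv] vb] vz] [[[Hw Pw] wb] wz]; apply: normA_stiffness.
- by split; [exact: H1_B|exact: piecewise_P1_B].
- by move=> a /vtx_bdry ba /=; rewrite vb// wb// subrr.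
- by move=> i /=; rewrite vz wz !mxE.
Qed.

End stiffness_matrix.

(** * Self-adjoint matrices *)

Section euclidean.
Context {R : realType} (n : nat).
Implicit Types (x y v : 'cV[R]_n) (M A B : 'M[R]_n).

Lemma dotcC x y : dotc x y = dotc y x.
Proof. by apply: eq_bigr => i _; rewrite mulrC. Qed.

Lemma dotcDl x x' y : dotc (x + x') y = dotc x y + dotc x' y.
Proof. by rewrite /dotc -big_split; apply: eq_bigr => i _; rewrite mxE mulrDl. Qed.

Lemma dotcZl c x y : dotc (c *: x) y = c * dotc x y.
Proof. by rewrite /dotc big_distrr; apply: eq_bigr => i _; rewrite mxE /= mulrA. Qed.

Lemma dotc_suml (I : Type) (s : seq I) (P : pred I) (F : I -> 'cV[R]_n) y :
  dotc (\sum_(i <- s | P i) F i) y = \sum_(i <- s | P i) dotc (F i) y.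
Proof.
apply: (big_morph (fun x => dotc x y)) => [x x'|]; first exact: dotcDl.
by rewrite -(scale0r 0) dotcZl mul0r.
Qed.

Lemma dotc_sumr (I : Type) (s : seq I) (P : pred I) (F : I -> 'cV[R]_n) x :
  dotc x (\sum_(i <- s | P i) F i) = \sum_(i <- s | P i) dotc x (F i).
Proof. by rewrite dotcC dotc_suml; apply: eq_bigr => i _; rewrite dotcC. Qed.

Lemma dotcZr c x y : dotc x (c *: y) = c * dotc x y.
Proof. by rewrite dotcC dotcZl dotcC. Qed.

Lemma dotcDr x y y' : dotc x (y + y') = dotc x y + dotc x y'.
Proof. by rewrite dotcC dotcDl !(dotcC x). Qed.

Lemma dotc_mulmx M x y : dotc (M *m x) y = dotc x (M^T *m y).
Proof.
rewrite /dotc; under eq_bigr do rewrite mxE big_distrl.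
rewrite exchange_big; apply: eq_bigr => j _; rewrite mxE big_distrr.
by apply: eq_bigr => i _ /=; rewrite mxE; ring.
Qed.

Lemma dotc_ge0 x : 0 <= dotc x x.
Proof. by apply: sumr_ge0 => i _; rewrite -expr2 sqr_ge0. Qed.

Lemma dotc_eq0 x : dotc x x = 0 -> x = 0.
Proof.
move=> /eqP; rewrite psumr_eq0 => [/allP h|i _]; last by rewrite -expr2 sqr_ge0.
apply/matrixP => i j; rewrite (ord1 j) mxE; apply/eqP.
by have := h i (mem_index_enum i); rewrite /= mulf_eq0 orbb.
Qed.

(** A zero of a semidefinite form minimises it. Moving from [v] in the direction [- A v] would make
    the form negative unless [A v = 0]. *)
Lemma psd_eq0 A v : A^T = A -> (forall x, 0 <= dotc (A *m x) x) ->
  A \in unitmx -> dotc (A *m v) v = 0 -> v = 0.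
Proof.
move=> At A0 uA v0; suff h : A *m v = 0 by rewrite -(mulKmx uA v) h mulmx0.
apply: dotc_eq0; set w := A *m v.
have wAw : 0 <= dotc (A *m w) w by [].
apply/eqP; rewrite eq_le dotc_ge0 andbT leNgt; apply/negP => w0.
(* The form at [v - t w] is [- 2 t |w|^2 + t^2 q]. The chosen [t] turns it into
   [- t |w|^2 - t^2 < 0]; the [+ 1] covers [q = 0]. *)
pose q := dotc (A *m w) w; have q0 : 0 < q + 1 by rewrite ltr_wpDl.
pose t := dotc w w / (q + 1); have t0 : 0 < t by rewrite divr_gt0.
have tE : t * q = dotc w w - t by rewrite /t; field; rewrite gt_eqF.
have := A0 (v + (- t) *: w).
rewrite mulmxDr -scalemxAr -/w !(dotcDl, dotcDr, dotcZl, dotcZr) (dotc_mulmx A w v) At -/w v0 -/q.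
have : t * (t * q) = t * (dotc w w - t) by rewrite tE.
by have := mulr_gt0 t0 w0; nra.
Qed.
End euclidean.

Section eigenvector_decomposition.
Context {R : realType} (n : nat) (A M : 'M[R]_n.+1).
Hypothesis symA : A^T = A.
Hypothesis psdA : forall x, 0 <= dotc (A *m x) x.
Hypothesis unitA : A \in unitmx.
Hypothesis adjM : forall x y, dotc (A *m (M *m x)) y = dotc (A *m x) (M *m y).
Implicit Types (s t : seq R) (v x y : 'cV[R]_n.+1) (w : R -> 'cV[R]_n.+1).

(** Induction on the factors: [(M - l) v] is a sum of eigenvectors, and dividing each component by
    [m - l] reduces to [(M - l) v' = y] with [y] in the [l]-eigenspace. Self-adjointness excludes
    such a Jordan chain, even when [l] is repeated in [s]. *)
Lemma selfadjoint_decomposition s v :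
  horner_mx M (\prod_(l <- s) ('X - l%:P)) *m v = 0 ->
  exists t w, [/\ uniq t, {subset t <= s}, forall l, M *m w l = l *: w l &
    v = \sum_(l <- t) w l].
Proof.
elim: s v => [v|l s IH v].
  rewrite big_nil rmorph1 mul1mx => ->.
  exists [::], (fun=> 0); split => //; last by rewrite big_nil.
  by move=> l; rewrite mulmx0 scaler0.
rewrite big_cons mulrC rmorphM -mulmxA.
rewrite rmorphB /= horner_mx_X horner_mx_C mulmxBl mul_scalar_mx.
move=> /IH[t [w [ut ts wE vE]]].
pose t' := [seq m <- t | m != l].
pose v' := v - \sum_(m <- t') (m - l)^-1 *: w m.
pose y := \sum_(m <- t | m == l) w m.
have yE : M *m v' - l *: v' = y.
  rewrite [LHS](_ : _ = (M *m v - l *: v) -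
      (M *m (\sum_(m <- t') (m - l)^-1 *: w m) - l *: (\sum_(m <- t') (m - l)^-1 *: w m))); last first.
    by rewrite /v' mulmxBr scalerBr; apply/matrixP => a b; rewrite !mxE; ring.
  rewrite vE mulmx_sumr scaler_sumr -sumrB.
  rewrite [X in _ - X](_ : _ = \sum_(m <- t') w m); last first.
    rewrite !big_filter; apply: eq_bigr => m /= ml.
    by rewrite -scalemxAr wE !scalerA mulrC -scalerBl -mulrBl mulfV ?scale1r// subr_eq0.
  by rewrite (bigID (pred1 l))/= big_filter -/y addrK.
have My : M *m y = l *: y.
  rewrite /y mulmx_sumr scaler_sumr; apply: eq_bigr => m /eqP ->; exact: wE.
(* [(A y, y) = (A y, (M - l) v') = (A (M - l) y, v') = 0]. *)
have y0 : y = 0.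
  apply: (psd_eq0 symA psdA unitA).
  rewrite -[X in dotc (A *m X) _]yE mulmxBr -scalemxAr dotcDl -scaleN1r dotcZl dotcZl adjM My dotcZr.
  by rewrite mulN1r subrr.
exists (l :: t'), (fun m => if m == l then v' else (m - l)^-1 *: w m); split.
- by rewrite /= filter_uniq// mem_filter /= eqxx.
- move=> m; rewrite !inE mem_filter => /orP[->//|/andP[_ /ts ->]]; exact: orbT.
- move=> m; case: eqP => [->|_].
    by apply/eqP; rewrite -subr_eq0 yE y0.
  by rewrite -scalemxAr wE !scalerA mulrC.
- rewrite big_cons eqxx -[LHS](subrK (\sum_(m <- t') (m - l)^-1 *: w m)); congr (_ + _).
  by rewrite !big_filter; apply: eq_bigr => m /= /negbTE ->.
Qed.

Lemma eigenvectors_orthogonal w l m : (forall l, M *m w l = l *: w l) -> l != m ->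
  dotc (A *m w l) (w m) = 0.
Proof.
move=> wE lm; have := adjM (w l) (w m).
rewrite !wE -scalemxAr dotcZl dotcZr => /eqP.
by rewrite -subr_eq0 -mulrBl mulf_eq0 subr_eq0 (negbTE lm) => /eqP.
Qed.

End eigenvector_decomposition.

Lemma seq_max (R : realType) (s : seq R) : s != [::] ->
  exists2 l, l \in s & forall m, m \in s -> m <= l.
Proof.
elim: s => // x [|y s] IH _.
  by exists x; rewrite ?mem_head// => m; rewrite inE => /eqP ->.
have [//|l ls lm] := IH; have [xl|lx] := leP x l.
  by exists l; [rewrite inE ls orbT|move=> m; rewrite inE => /orP[/eqP ->//|/lm]].
exists x; first exact: mem_head.
by move=> m; rewrite inE => /orP[/eqP ->//|/lm /le_trans]; apply; exact: ltW.
Qed.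

(** * Asymptotics of the residual ratios *)

(** Split [t = s^2]: one factor [s^k] absorbs [k + 1], since [(k + 1) s^k] is at most the geometric
    sum [1 + ... + s^k], and the other tends to [0]. *)
Lemma natS_mul_expr_cvg0 (R : realType) (t : R) : 0 <= t < 1 ->
  (fun k => k.+1%:R * t ^+ k) @ \oo --> (0 : R).
Proof.
move=> /andP[t0 t1].
have [->|tn0] := eqVneq t 0.
  apply: cvg_near_cst; near=> k; have k0 : (0 < k)%N by near: k; exact: nbhs_infty_gt.
  by rewrite expr0n gtn_eqF// mulr0.
pose s := Num.sqrt t.
have s0 : 0 < s by rewrite sqrtr_gt0 lt_neqAle eq_sym tn0.
have sE : t = s ^+ 2 by rewrite sqr_sqrtr.
have s1 : s < 1 by rewrite -sqrtr1 ltr_sqrt.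
have bnd k : k.+1%:R * s ^+ k <= (1 - s)^-1.
  have : k.+1%:R * s ^+ k <= \sum_(i < k.+1) s ^+ i.
    rewrite -[X in X%:R * _]card_ord -sumr_const mulr_suml; apply: ler_sum => i _.
    by rewrite mul1r ler_wiXn2l// ?ltW// -ltnS.
  move=> /le_trans; apply; rewrite -(ler_pM2l (x := 1 - s)) ?subr_gt0//.
  have := subrX1 s k.+1; rewrite mulfV ?gt_eqF ?subr_gt0// => h.
  have := exprn_ge0 k.+1 (ltW s0); lra.
apply: (@squeeze_cvgr _ _ _ _ (cst 0) (fun k => s ^+ k * (1 - s)^-1)).
- near=> k; rewrite mulr_ge0 ?exprn_ge0//= sE -exprM mulnC exprM expr2.
  rewrite mulrA mulrC ler_wpM2l ?exprn_ge0// ltW//.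
- exact: cvg_cst.
- rewrite -[0](mul0r (1 - s)^-1); apply: cvgMr_tmp; apply: cvg_expr.
  by rewrite ger0_norm ?ltW.
Unshelve. all: by end_near. Qed.

(** The endpoint [t = 1] is allowed because the increment then vanishes; this is the case of the
    dominant term. *)
Lemma scaled_increment_cvg0 (R : realType) (t : R) : 0 <= t <= 1 ->
  (fun k => k.+1%:R * (t ^+ k.+1 - t ^+ k)) @ \oo --> (0 : R).
Proof.
move=> /andP[t0]; rewrite le_eqVlt => /predU1P[->|t1].
  rewrite (_ : (fun _ => _) = cst 0); first exact: cvg_cst.
  by apply/funext => k; rewrite !expr1n subrr mulr0.
rewrite (_ : (fun k => _) = (fun k => k.+1%:R * t ^+ k * (t - 1))); last first.
  by apply/funext => k; rewrite exprS; ring.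
rewrite -[X in _ --> X](mul0r (t - 1)); apply: cvgMr_tmp.
by apply: natS_mul_expr_cvg0; rewrite t0.
Qed.

Lemma expr_cvg_indicator (R : realType) (t : R) : 0 <= t <= 1 ->
  (fun k => t ^+ k) @ \oo --> ((t == 1)%:R : R).
Proof.
move=> /andP[t0]; rewrite le_eqVlt => /predU1P[->|t1].
  rewrite eqxx (_ : (fun _ => _) = cst 1); first exact: cvg_cst.
  by apply/funext => k; rewrite expr1n.
by rewrite lt_eqF//; apply: cvg_expr; rewrite ger0_norm.
Qed.

(** [q - 1 = (sqrt q - 1) (sqrt q + 1)] with second factor at least [1]. It reduces ratios of norms
    to ratios of squared norms. *)
Lemma norm_sqrt_sub1 (R : realType) (q : R) : 0 <= q -> `|Num.sqrt q - 1| <= `|q - 1|.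
Proof.
move=> q0; have s0 := sqrtr_ge0 q.
rewrite -{2}(sqr_sqrtr q0) subr_sqr_1 normrM ler_peMr// ger0_norm ?addr_ge0//.
by rewrite lerDr.
Qed.

(* With [l] the dominant eigenvalue present in the initial error, the bound asks for
   [k (rho_k - l) + rho_k (1 - l) >= 0]; since [k (rho_k - l)] tends to [0],
   the slack [1/k <= expR (1/k) - 1] absorbs the error of [rho_k] as an
   approximation of [l]. *)
Lemma ratio_bound (R : realType) (l rho : R) (k : nat) : (0 < k)%N ->
  0 < l < 1 -> k%:R * `|rho - l| <= l * (1 - l) / 4 ->
  l / (1 - l) <= expR (k%:R^-1) * (rho / (1 - rho)).
Proof.
move=> k0 /andP[l0 l1] H; have k1 : 1 <= k%:R :> R by rewrite ler1n.
have kp : 0 < k%:R :> R by rewrite ltr0n.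
have Hd : `|rho - l| <= l * (1 - l) / 4.
  by apply: le_trans H; rewrite ler_peMl.
have l1' : 0 < 1 - l by rewrite subr_gt0.
have ll : 0 < l * (1 - l) by rewrite mulr_gt0.
have [r0 r1] : 0 < rho /\ rho < 1.
  move: Hd; rewrite ler_norml => /andP[h1 h2]; split; nra.
have r1' : 0 < 1 - rho by rewrite subr_gt0.
apply: (@le_trans _ _ ((1 + k%:R^-1) * (rho / (1 - rho)))); last first.
  by rewrite ler_pM2r ?divr_gt0// expR_ge1Dx.
rewrite mulrA ler_pdivlMr// mulrAC ler_pdivrMr//.
rewrite -(ler_pM2l kp).
have -> : k%:R * ((1 + k%:R^-1) * rho * (1 - l)) = (k%:R + 1) * rho * (1 - l).
  by field; rewrite gt_eqF.
(* With [eps = l (1 - l) / 4], the term [k (rho - l)] is at least [- eps], while [rho (1 - l) >= (l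
   - eps) (1 - l) >= 3 eps]. *)
have Hk : - (l * (1 - l) / 4) <= k%:R * (rho - l).
  have : `|k%:R * (rho - l)| <= l * (1 - l) / 4 by rewrite normrM ger0_norm// ltW.
  by rewrite ler_norml => /andP[].
have Hr : l - l * (1 - l) / 4 <= rho by move: Hd; rewrite ler_norml => /andP[]; lra.
have : (l - l * (1 - l) / 4) * (1 - l) <= rho * (1 - l) by rewrite ler_pM2r.
have : l * (1 - l) * (1 - l) <= l * (1 - l) * 1 by rewrite ler_pM2l//; lra.
by move: Hk ll; move: k%:R => a; nra.
Qed.

(** * Errors and residuals expanded in eigenvectors *)

Section error_estimate.
Context {R : realType} (n : nat).
Implicit Types (A B : 'M[R]_n) (w : R -> 'cV[R]_n).

Lemma dotc_orthogonal_sum A t w (c : R -> R) : uniq t ->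
  (forall l m, l != m -> dotc (A *m w l) (w m) = 0) ->
  dotc (A *m (\sum_(m <- t) c m *: w m)) (\sum_(m <- t) c m *: w m) =
  \sum_(m <- t) c m ^+ 2 * dotc (A *m w m) (w m).
Proof.
move=> ut ow; rewrite mulmx_sumr dotc_suml; apply: eq_big_seq => m mt.
rewrite dotc_sumr (bigD1_seq m)//= [X in _ + X]big1 ?addr0 => [|p pm].
  by rewrite -scalemxAr dotcZl dotcZr; ring.
by rewrite -scalemxAr dotcZl dotcZr ow ?mulr0// eq_sym.
Qed.

Lemma normA_le_increment A t w (l : R) k : uniq t ->
  (forall x, 0 <= dotc (A *m x) x) ->
  (forall l m, l != m -> dotc (A *m w l) (w m) = 0) ->
  0 <= l < 1 -> (forall m, m \in t -> 0 <= m <= l) ->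
  normA A (\sum_(m <- t) m ^+ k.+1 *: w m) <=
  l / (1 - l) * normA A (\sum_(m <- t) m ^+ k *: w m - \sum_(m <- t) m ^+ k.+1 *: w m).
Proof.
move=> ut psd ow /andP[l0 l1] tl; have l1' : 0 < 1 - l by rewrite subr_gt0.
have -> : \sum_(m <- t) m ^+ k *: w m - \sum_(m <- t) m ^+ k.+1 *: w m =
    \sum_(m <- t) (m ^+ k * (1 - m)) *: w m.
  by rewrite -sumrB; apply: eq_bigr => m _; rewrite -scalerBl; congr (_ *: _); rewrite exprS; ring.
have c0 : 0 <= l / (1 - l) by rewrite divr_ge0// ltW.
rewrite /normA !dotc_orthogonal_sum// -(ger0_norm c0) -sqrtr_sqr -sqrtrM ?sqr_ge0//.
rewrite ler_wsqrtr// mulr_sumr !big_seq; apply: ler_sum => m /tl /andP[m0 ml].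
(* This is monotonicity of [m / (1 - m)] on [[0, 1)]. *)
have key : m ^+ k.+1 <= l / (1 - l) * (m ^+ k * (1 - m)).
  rewrite exprS mulrC [leRHS]mulrCA ler_wpM2l ?exprn_ge0// mulrAC ler_pdivlMr//.
  nra.
have m1 : 0 <= m ^+ k.+1 by exact: exprn_ge0.
by rewrite mulrA ler_wpM2r// -exprMn ler_sqr// nnegrE// (le_trans m1).
Qed.

Lemma unitmx_of_eigenvalues A B (lam : seq R) : eigenvalues_of (1%:M - B *m A) lam ->
  1 \notin lam -> A \in unitmx.
Proof.
move=> clam n1; have : \det (B *m A) != 0.
  apply/negP => /det0P[v v0 vBA]; move/negP: n1; apply.
  rewrite -root_prod_XsubC -clam -eigenvalue_root_char; apply/eigenvalueP; exists v => //.
  by rewrite mulmxBr mulmx1 vBA subr0 scale1r.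
by rewrite det_mulmx mulf_eq0 negb_or unitmxE unitfE => /andP[].
Qed.

Definition residual_sqr A t w k : R :=
  \sum_(m <- t) \sum_(p <- t) (m * p) ^+ k * dotc (A *m w m) (A *m w p).

Lemma dotc_residual A t w k :
  dotc (A *m (\sum_(m <- t) m ^+ k *: w m)) (A *m (\sum_(m <- t) m ^+ k *: w m)) =
  residual_sqr A t w k.
Proof.
rewrite mulmx_sumr dotc_suml; apply: eq_bigr => m _.
rewrite dotc_sumr; apply: eq_bigr => p _.
by rewrite -!scalemxAr dotcZl dotcZr exprMn mulrA.
Qed.

(** The ratio is [l * sqrt (a (k+1) / a k)], where [a k] is the squared residual norm divided by
    [l^(2k)]. As [a] has a positive limit, it suffices that its increments times [k + 1] tend to
    [0]. *)
Lemma rho_err_cvg A t w (l : R) : uniq t -> l \in t -> 0 < l ->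
  (forall m, m \in t -> 0 < m <= l) -> A *m w l != 0 ->
  (fun k => k.+1%:R * (rho_err (fun k => A *m (\sum_(m <- t) m ^+ k *: w m)) k.+1 - l))
    @ \oo --> (0 : R).
Proof.
move=> ut lt l0 tl Awl; have l20 : l ^+ 2 != 0 by rewrite expf_neq0 ?gt_eqF.
pose tau m p := m * p / l ^+ 2.
have tau01 m p : m \in t -> p \in t -> 0 <= tau m p <= 1.
  move=> /tl /andP[m0 ml] /tl /andP[p0 pl]; rewrite /tau divr_ge0 ?sqr_ge0 ?mulr_ge0 ?(ltW m0) ?(ltW p0)//=.
  by rewrite ler_pdivrMr ?exprn_gt0// mul1r expr2 ler_pM// ltW.
have tau1 m p : m \in t -> p \in t -> tau m p = 1 -> m = l /\ p = l.
  move=> /tl /andP[m0 ml] /tl /andP[p0 pl] tau1.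
  have E : m * p = l ^+ 2.
    by rewrite -[LHS](@divfK _ (l ^+ 2))// -/(tau m p) tau1 mul1r.
  by split; apply/eqP; rewrite eq_le ?ml ?pl/=; nra.
pose C m p := dotc (A *m w m) (A *m w p).
have C0 : 0 < C l l.
  by rewrite lt_neqAle dotc_ge0 andbT eq_sym; apply: contraNN Awl => /eqP/dotc_eq0 ->.
pose a k := \sum_(m <- t) \sum_(p <- t) tau m p ^+ k * C m p.
have aE k : residual_sqr A t w k = (l ^+ 2) ^+ k * a k.
  rewrite /a mulr_sumr; apply: eq_bigr => m _; rewrite mulr_sumr; apply: eq_bigr => p _.
  by rewrite mulrA -exprMn /tau (mulrC (l ^+ 2)) divfK.
have a_cvg : a @ \oo --> C l l.
  have -> : C l l = \sum_(m <- t) \sum_(p <- t) (tau m p == 1)%:R * C m p.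
    rewrite (bigD1_seq l)//= [X in _ + X]big1_seq => [|m /andP[ml mt]]; last first.
      rewrite big1_seq// => p /= pt; case: eqP => [/tau1[]// mE _|]; last by rewrite mul0r.
      by rewrite mE eqxx in ml.
    rewrite addr0 (bigD1_seq l)//= big1_seq => [|p /andP[pl pt]].
      by rewrite /tau -expr2 divff// eqxx mul1r addr0.
    by case: eqP => [/tau1[]// _ pE|]; [rewrite pE eqxx in pl|rewrite mul0r].
  (* [big_seq] adds membership in [t] to the sums, which [tau01] needs. *)
  rewrite /a; under eq_fun do rewrite big_seq; rewrite big_seq.
  apply: cvg_big => [|m mt]; first exact: add_continuous.
  under eq_fun do rewrite big_seq; rewrite big_seq.
  apply: cvg_big => [|p pt]; first exact: add_continuous.
  by apply: cvgMr_tmp; apply: expr_cvg_indicator; exact: tau01.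
have da_cvg : (fun k => k.+1%:R * (a k.+1 - a k)) @ \oo --> (0 : R).
  rewrite (_ : (fun k => _) = (fun k => \sum_(m <- t) \sum_(p <- t)
      k.+1%:R * (tau m p ^+ k.+1 - tau m p ^+ k) * C m p)); last first.
    apply/funext => k; rewrite /a -sumrB mulr_sumr; apply: eq_bigr => m _.
    by rewrite -sumrB mulr_sumr; apply: eq_bigr => p _; ring.
  rewrite [X in _ --> X](_ : 0 = \sum_(m <- t | m \in t) \sum_(p <- t | p \in t) 0 * C m p :> R); last first.
    by rewrite big1// => m _; rewrite big1// => p _; rewrite mul0r.
  under eq_fun do rewrite big_seq.
  apply: cvg_big => [|m mt]; first exact: add_continuous.
  under eq_fun do rewrite big_seq.
  apply: cvg_big => [|p pt]; first exact: add_continuous.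
  by apply: cvgMr_tmp; apply: scaled_increment_cvg0; exact: tau01.
have q_cvg : (fun k => l * `|k.+1%:R * (a k.+1 - a k) / a k|) @ \oo --> (0 : R).
  rewrite -(mulr0 l); apply: cvgMl_tmp; rewrite -(normr0 R); apply: cvg_norm.
  rewrite -(mul0r (C l l)^-1); apply: cvgM => //; apply: cvgV => //.
  by rewrite gt_eqF.
apply/cvgr0Pnorm_le => eps eps0.
have a_pos : \forall k \near \oo, 0 < a k by exact: cvgr_gt a_cvg _ C0.
have a_pos' : \forall k \near \oo, 0 < a k.+1 by apply: cvgr_gt C0; rewrite (cvg_shiftS a).
near=> k; have ak : 0 < a k by near: k.
have ak1 : 0 < a k.+1 by near: k.
have : l * `|k.+1%:R * (a k.+1 - a k) / a k| <= eps.
  near: k; have /cvgr0Pnorm_le/(_ eps eps0) := q_cvg; apply: filterS => k.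
  by rewrite ger0_norm// mulr_ge0// ltW.
apply: le_trans.
rewrite /rho_err /norm2 !dotc_residual !aE.
have sq j : Num.sqrt ((l ^+ 2) ^+ j * a j) = l ^+ j * Num.sqrt (a j).
  rewrite (sqrtrM _ (exprn_ge0 j (sqr_ge0 l))) -exprM mulnC exprM sqrtr_sqr ger0_norm//.
  by rewrite exprn_ge0// ltW.
rewrite !sq (_ : l ^+ k.+1 * Num.sqrt (a k.+1) / (l ^+ k * Num.sqrt (a k)) = l * Num.sqrt (a k.+1 / a k)); last first.
  rewrite sqrtrM ?(ltW ak1)// sqrtrV ?(ltW ak)// exprS.
  by field; rewrite expf_neq0 ?gt_eqF// sqrtr_gt0.
rewrite -[X in _ - X]mulr1 -mulrBr mulrCA normrM (ger0_norm (ltW l0)) ler_pM2l//.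
rewrite -mulrA 2!normrM ler_wpM2l//.
apply: le_trans (norm_sqrt_sub1 _) _; first by rewrite divr_ge0// ltW.
by rewrite mulrBl divff// gt_eqF.
Unshelve. all: by end_near. Qed.
End error_estimate.

Lemma error_bound (R : realType) (n : nat) (A B : 'M[R]_n) (e : nat -> 'cV[R]_n)
    (lam : seq R) :
  A^T = A -> (forall x, 0 <= dotc (A *m x) x) -> B^T = B ->
  eigenvalues_of (1%:M - B *m A) lam -> (forall l, l \in lam -> 0 < l < 1) ->
  (forall k, e k.+1 = (1%:M - B *m A) *m e k) -> A *m e 0%N != 0 ->
  exists2 N, (0 < N)%N & forall k, (N <= k)%N ->
    normA A (e k.+1) <= eta_a (fun k => A *m e k) k (normA A (e k - e k.+1)).
Proof.
(* [horner_mx] and Cayley-Hamilton want a positive size; in size [0] the initial residual would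
   vanish. *)
case: n A B e => [|n] A B e symA psd symB clam lam01 eS e0.
  by move: e0; rewrite [_ *m _]flatmx0 eqxx.
have uA : A \in unitmx.
  by apply: (unitmx_of_eigenvalues clam); apply/negP => /lam01; rewrite ltxx andbF.
set M := 1%:M - B *m A in clam eS.
have adjM x y : dotc (A *m (M *m x)) y = dotc (A *m x) (M *m y).
  (* Both sides equal [A - A B A], by symmetry of [A] and [B]. *)
  have E : A *m M = M^T *m A.
    by rewrite /M [(_ - _)^T]linearB/= tr_scalar_mx trmx_mul symA symB mulmxBr mulmxBl mulmx1 mul1mx mulmxA.
  by rewrite !(mulmxA A) E -mulmxA dotc_mulmx trmxK.
have [t [w [ut tlam wE vE]]] : exists t w, [/\ uniq t, {subset t <= lam},
    forall l, M *m w l = l *: w l & e 0%N = \sum_(l <- t) w l].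
  apply: (selfadjoint_decomposition symA psd uA adjM).
  by rewrite -clam Cayley_Hamilton mul0mx.
have ow := eigenvectors_orthogonal adjM wE.
(* The decomposition may contain zero vectors. Discarding them makes the maximum of [t'] an
   eigenvalue really present in the initial error. *)
pose t' := [seq m <- t | w m != 0].
have ut' : uniq t' by rewrite filter_uniq.
have ek k : e k = \sum_(m <- t') m ^+ k *: w m.
  elim: k => [|k IH].
    rewrite vE (bigID (fun m => w m != 0))/= [X in _ + X]big1 ?addr0.
      by rewrite big_filter; apply: eq_bigr => m _; rewrite expr0 scale1r.
    by move=> m; rewrite negbK => /eqP.
  rewrite eS IH mulmx_sumr; apply: eq_bigr => m _.
  by rewrite -scalemxAr wE scalerA exprSr.
have t'0 : t' != [::].
  apply: contraNneq e0 => t'0.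
  by rewrite ek t'0 big_nil mulmx0.
have [l lt' lmax] := seq_max t'0.
have t'01 m : m \in t' -> 0 < m < 1 by rewrite mem_filter => /andP[_ /tlam /lam01].
have /andP[l0 l1] := t'01 _ lt'.
have Awl : A *m w l != 0.
  apply: contraTneq lt' => Aw0; rewrite mem_filter negb_and negbK.
  by rewrite -(mulKmx uA (w l)) Aw0 mulmx0 eqxx.
have t'l m : m \in t' -> 0 < m <= l.
  by move=> mt; rewrite lmax// andbT; case/andP: (t'01 _ mt).
have /cvgr0Pnorm_le H := rho_err_cvg ut' lt' l0 t'l Awl.
have eps0 : 0 < l * (1 - l) / 4 by rewrite divr_gt0// mulr_gt0// subr_gt0.
have [N _ HN] := H _ eps0.
(* The limit is stated for the ratio with index [k + 1], hence the shift by one. *)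
exists N.+1 => // -[//|k] Nk; rewrite /eta_a.
have rE : rho_err (fun k => A *m e k) k.+1 =
    rho_err (fun k => A *m (\sum_(m <- t') m ^+ k *: w m)) k.+1.
  by rewrite /rho_err !ek.
have hk := HN k Nk; rewrite /= -rE normrM ger0_norm// in hk.
have l01 : 0 < l < 1 by rewrite l0.
have nA0 : 0 <= normA A (e k.+1 - e k.+2) by exact: sqrtr_ge0.
apply: le_trans (ler_wpM2r nA0 (ratio_bound (ltn0Sn k) l01 hk)).
rewrite !ek; apply: normA_le_increment => //; first by rewrite ltW.
by move=> m /t'l /andP[m0 ml]; rewrite ltW.
Qed.

Lemma sorted_ge_head (R : realType) (s : seq R) l :
  sorted >=%R s -> l \in s -> l <= s`_0.
Proof.
case: s => // x s /= xs; rewrite inE => /predU1P[->//|ls].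
exact: (allP (order_path_min ge_trans xs)).
Qed.

Unset Implicit Arguments.

Theorem theorem4p4 (R : realType) (d : nat) (Omega : set 'rV[R]_d)
    (T : mesh R d) (sigma tau : R) (A f g uT : 'rV[R]_d -> R)
    (n : nat) (z : 'I_n -> 'I_(nvtx T)) (phi : 'I_n -> 'rV[R]_d -> R)
    (gh : 'rV[R]_d -> R) (AA BB : 'M[R]_n) (ff u : 'cV[R]_n)
    (uk e r : nat -> 'cV[R]_n) (uTk : nat -> 'rV[R]_d -> R) (lam : seq R)
    (hd : d = 2%N \/ d = 3%N)
    (hOmega : polyhedral_domain Omega)
    (hT : triangulation Omega T)
    (hshape : shape_regular sigma T)
    (hquasi : quasi_uniform tau T)
    (hA : piecewise_constant Omega T A)
    (hApos : forall x, Omega x -> 0 < A x)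
    (hf : piecewise_constant Omega T f)
    (hg : trace_of_S1 Omega T g)
    (huT : fe_solution Omega T A f g uT)
    (hz : interior_vertices Omega z)
    (hphi : nodal_basis Omega z phi)
    (hgh : boundary_lift Omega T g gh)
    (hAA : AA = stiffness Omega A phi)
    (hff : ff = load Omega A f gh phi)
    (hBB : BB^T = BB)
    (hu : AA *m u = ff)
    (huk : forall k, uk k.+1 = uk k + BB *m (ff - AA *m uk k))
    (he : forall k, e k = u - uk k)
    (hr : forall k, r k = AA *m e k)
    (hr0 : r 0%N != 0)
    (huTk : forall k, fe_function Omega z g (uk k) (uTk k))
    (hlam : eigenvalues_of (1%:M - BB *m AA) lam)
    (hlam_sorted : sorted >=%R lam)
    (hlam_pos : forall l, l \in lam -> 0 < l)
    (hrho : spectral_radius (1%:M - BB *m AA) = lam`_0)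
    (hrho1 : spectral_radius (1%:M - BB *m AA) < 1) :
  (forall k, (1 <= k)%N ->
     eta_a r k (normA AA (uk k.+1 - uk k)) =
     eta_a r k (energy_norm Omega A (uTk k.+1 \- uTk k))) /\
  exists2 N, (0 < N)%N &
    forall k, (N <= k)%N ->
      normA AA (e k.+1) = energy_norm Omega A (uT \- uTk k.+1) /\
      normA AA (e k.+1) <= eta_a r k (normA AA (uk k.+1 - uk k)).
Proof.
have uA : AA \in unitmx.
  apply: (unitmx_of_eigenvalues hlam); apply/negP => /(sorted_ge_head hlam_sorted).
  by rewrite -hrho leNgt hrho1.
have lam01 l : l \in lam -> 0 < l < 1.
  move=> ll; rewrite hlam_pos//=; apply: le_lt_trans hrho1.
  by rewrite hrho; exact: sorted_ge_head.
(* Both vectors solve the same system, and [AA] is invertible. *)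
have uTE : (\col_i uT (vtx (z i))) = u.
  have := fe_solution_coeff hOmega hT hA hz hphi hgh huT.
  by rewrite -hAA -hff -hu => /(congr1 (mulmx (invmx AA))); rewrite !mulKmx.
have fuT : fe_function Omega z g u uT.
  by split; [case: huT|move=> i; rewrite -uTE mxE].
split=> [k _|].
  by rewrite hAA (normA_fe_functions hOmega hT hA hz hphi (huTk k.+1) (huTk k)).
have eS k : e k.+1 = (1%:M - BB *m AA) *m e k.
  rewrite !he huk -hu mulmxBl mul1mx -mulmxA -[AA *m u - _]mulmxBr.
  by rewrite opprD addrA.
have AAT : AA^T = AA by rewrite hAA; exact: stiffness_sym.
have psd x : 0 <= dotc (AA *m x) x.
  by rewrite hAA; exact: (stiffness_psd hOmega hA hphi).
have e0 : AA *m e 0%N != 0 by rewrite -hr.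
have [N N0 HN] := error_bound AAT psd hBB hlam lam01 eS e0.
exists N => // k Nk; split.
  by rewrite {1}he hAA (normA_fe_functions hOmega hT hA hz hphi fuT (huTk k.+1)).
have -> : r = (fun k => AA *m e k) by apply/funext.
have -> : uk k.+1 - uk k = e k - e k.+1 by rewrite !he; apply/matrixP => i j; rewrite !mxE; ring.
exact: HN.
Qed.
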